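(* Let $\Gamma=H_1*_K H_2$ be an amalgamated free product of abstract groups, where $K$ is a common subgroup of $H_1$ and $H_2$, let $p$ be a prime, let $P=\widehat\Gamma_p$, and let $\rho:\Gamma\to P$ be the canonical map. Put $V_i=\overline{\rho(H_i)}$ for $i=1,2$ and $B=V_1\cap V_2$. Then the natural inclusions $V_i\hookrightarrow P$ induce an isomorphism $P\cong V_1\amalg_B V_2$, and the amalgam on the right is proper. If moreover $H_1$ and $H_2$ are boundedly generated, then $P$ is boundedly generated if and only if either $B=V_1$ or $B=V_2$, or $p=[V_1:B]=[V_2:B]=2$.
   Context: An abstract group $G$ is boundedly generated if $G=\langle g_1\rangle\cdots\langle g_d\rangle$ for finitely many $g_1,\dots,g_d\in G$. A profinite group $G$ is boundedly generated if $G=\overline{\langle g_1\rangle}\cdots\overline{\langle g_d\rangle}$ for finitely many $g_1,\dots,g_d\in G$. $\widehat\Gamma_p$ is the pro-$p$ completion of $\Gamma$. For pro-$p$ groups $V_1,V_2$ with a common closed subgroup $B$, $V_1\amalg_B V_2$ is the pushout of $V_1\leftarrow B\rightarrow V_2$ in the category of pro-$p$ groups and continuous homomorphisms; it is proper if the canonical maps $V_i\to V_1\amalg_B V_2$ are injective. *)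

(* Defs.v *)
From HB Require Import structures.
From mathcomp Require Import all_boot.
From mathcomp Require Import boolp classical_sets functions cardinality.
From mathcomp Require Import topology.

Set Implicit Arguments.
Unset Strict Implicit.
Unset Printing Implicit Defensive.

Local Open Scope classical_set_scope.
Local Open Scope card_scope.
Local Open Scope group_scope.

Notation "{ 'ghom' G -> H }" := (UMagmaMorphism.type G%type H%type)
  (at level 0, G at level 98, H at level 99,
   format "{ 'ghom'  G  ->  H }") : type_scope.

Record subgroup (G : groupType) := Subgroup {
  subgroup_set :> set G;
  subgroup1 : subgroup_set 1;
  subgroupF : forall x y,
    subgroup_set x -> subgroup_set y -> subgroup_set (x / y)
}.

Definition normal_subgroup (G : groupType) (N : subgroup G) : Prop :=
  forall x : G, [set y ^ x | y in N] `<=` N.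

Section SubgroupType.
Variables (G : groupType) (V : subgroup G).

Lemma subgroup_group_closed : group_closed (fun x : G => x \in (V : set G)).
Proof.
split; first exact/mem_set/subgroup1.
by move=> x y /set_mem Vx /set_mem Vy; exact/mem_set/subgroupF.
Qed.

HB.instance Definition _ := SubChoice.on (set_type V).
HB.instance Definition _ :=
  SubChoice_isSubGroup.Build G (fun x : G => x \in (V : set G))
    (set_type V) subgroup_group_closed.

End SubgroupType.

Section SubgroupMorphisms.
Variable G : groupType.
Implicit Types U V : subgroup G.

Lemma set_val_monoid_morphism V : monoid_morphism (@set_val G V).
Proof.
rewrite set_valE; split; first exact: (@gmulf1 _ _ (\val : V -> G)).
exact: (@gmulfM _ _ (\val : V -> G)).
Qed.

HB.instance Definition _ V :=
  isUMagmaMorphism.Build V G (@set_val G V) (@set_val_monoid_morphism V).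

Lemma subfun_monoid_morphism U V (UV : (U : set G) `<=` V) :
  monoid_morphism (subfun UV).
Proof.
split=> [|x y]; apply: val_inj.
  exact: etrans (@gmulf1 _ _ (\val : U -> G))
    (esym (@gmulf1 _ _ (\val : V -> G))).
exact: etrans (@gmulfM _ _ (\val : U -> G) x y)
  (esym (@gmulfM _ _ (\val : V -> G) (subfun UV x) (subfun UV y))).
Qed.

HB.instance Definition _ U V (UV : (U : set G) `<=` V) :=
  isUMagmaMorphism.Build U V (subfun UV) (subfun_monoid_morphism UV).

Lemma setI_subgroup1 U V : ((U : set G) `&` V) 1.
Proof. by split; exact: subgroup1. Qed.

Lemma setI_subgroupF U V (x y : G) :
  ((U : set G) `&` V) x -> ((U : set G) `&` V) y -> ((U : set G) `&` V) (x / y).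
Proof. by move=> [Ux Vx] [Uy Vy]; split; exact: subgroupF. Qed.

Definition setI_subgroup U V : subgroup G :=
  Subgroup (setI_subgroup1 U V) (@setI_subgroupF U V).

End SubgroupMorphisms.

Section RangeSubgroup.
Variables (G H : groupType) (f : {ghom G -> H}).

Lemma range_subgroup1 : range f 1.
Proof. by exists 1; rewrite // gmulf1. Qed.

Lemma range_subgroupF (x y : H) : range f x -> range f y -> range f (x / y).
Proof. by move=> [a _ <-] [b _ <-]; exists (a / b); rewrite // gmulfF. Qed.

Definition range_subgroup : subgroup H :=
  Subgroup range_subgroup1 range_subgroupF.

End RangeSubgroup.

(* [K] is regarded as a common subgroup of [H1] and [H2] through the
   injections [k1] and [k2]; [G] with [i1] and [i2] is then [H1 *_K H2]. *)
Definition is_amalgamated_product (K H1 H2 G : groupType)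
    (k1 : {ghom K -> H1}) (k2 : {ghom K -> H2})
    (i1 : {ghom H1 -> G}) (i2 : {ghom H2 -> G}) : Prop :=
  [/\ injective k1, injective k2, i1 \o k1 =1 i2 \o k2 &
    forall (L : groupType)
      (f1 : {ghom H1 -> L}) (f2 : {ghom H2 -> L}),
      f1 \o k1 =1 f2 \o k2 ->
      exists phi : {ghom G -> L},
        [/\ phi \o i1 =1 f1, phi \o i2 =1 f2 &
          forall psi : {ghom G -> L},
            psi \o i1 =1 f1 -> psi \o i2 =1 f2 -> psi =1 phi]].

Definition setM (G : groupType) (A B : set G) : set G :=
  [set a * b | a in A & b in B].

Definition cyclic_set (G : groupType) (g : G) : set G :=
  [set x | exists n : nat, x = g ^+ n \/ x = g ^- n].

(* [A : B] = n, as the number of cosets aB with a in A. *)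
Definition has_index (G : groupType) (A B : set G) (n : nat) : Prop :=
  [set setM [set a] B | a in A] #= `I_n.

Definition boundedly_generated (G : groupType) : Prop :=
  exists s : seq G, \big[@setM G/[set 1]]_(g <- s) cyclic_set g = [set: G].

HB.structure Definition PreTopologicalGroup :=
  {G of Topological G & Group G}.

HB.mixin Record PreTopologicalGroup_isTopologicalGroup G
    & PreTopologicalGroup G := {
  mulg_continuous : continuous (fun x : G * G => x.1 * x.2);
  invg_continuous : continuous (fun x : G => x^-1)
}.

#[short(type="topologicalGroupType")]
HB.structure Definition TopologicalGroup :=
  {G of PreTopologicalGroup G & PreTopologicalGroup_isTopologicalGroup G}.

Section TopologicalSubgroup.
Variable G : topologicalGroupType.
Implicit Types V : subgroup G.

(* The topology on [set_type V] is the subspace topology. *)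
HB.instance Definition _ V := Group.on (set_type V).
HB.instance Definition _ V := Topological.on (set_type V).

Lemma subgroup_mulg_continuous V : continuous (fun x : V * V => x.1 * x.2).
Proof.
apply: continuous_comp_initial => x.
rewrite (_ : _ \o _ = (fun z : G * G => z.1 * z.2) \o
    (fun z : V * V => (set_val z.1, set_val z.2))); last first.
  by apply/funext => z /=; rewrite gmulfM.
apply: continuous_comp; last exact: mulg_continuous.
apply: cvg_pair => /=.
  by apply: (@continuous_comp _ _ _ fst (@set_val G V));
    [exact: cvg_fst|exact: initial_continuous].
by apply: (@continuous_comp _ _ _ snd (@set_val G V));
  [exact: cvg_snd|exact: initial_continuous].
Qed.

Lemma subgroup_invg_continuous V : continuous (fun x : V => x^-1).
Proof.
apply: continuous_comp_initial => x.
rewrite (_ : _ \o _ = (fun x : G => x^-1) \o @set_val G V); last first.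
  by apply/funext => z /=; rewrite gmulfV.
by apply: continuous_comp; [exact: initial_continuous|exact: invg_continuous].
Qed.

HB.instance Definition _ V :=
  PreTopologicalGroup_isTopologicalGroup.Build (set_type V)
    (@subgroup_mulg_continuous V) (@subgroup_invg_continuous V).

Lemma closure_subgroup1 V : closure V 1.
Proof. exact/subset_closure/subgroup1. Qed.

Lemma closure_subgroupF V (x y : G) :
  closure V x -> closure V y -> closure V (x / y).
Proof.
move=> clx cly B nB.
have divc : {for (x, y), continuous (fun z : G * G => z.1 / z.2)}.
  apply: (@continuous_comp _ _ _ (fun z : G * G => (z.1, z.2^-1))
    (fun z => z.1 * z.2)); last exact: mulg_continuous.
  apply: cvg_pair; first exact: cvg_fst.
  by apply: (@continuous_comp _ _ _ snd (fun u : G => u^-1));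
    [exact: cvg_snd|exact: invg_continuous].
have [[B1 B2] /= [nB1 nB2] B12] := divc _ nB.
have [a [Va B1a]] := clx _ nB1; have [b [Vb B2b]] := cly _ nB2.
by exists (a / b); split; [exact: subgroupF|exact: (B12 (a, b))].
Qed.

Definition closure_subgroup V : subgroup G :=
  Subgroup (closure_subgroup1 V) (@closure_subgroupF V).

End TopologicalSubgroup.

Definition profinite (G : topologicalGroupType) : Prop :=
  [/\ compact [set: G], hausdorff_space G & totally_disconnected [set: G]].

Definition pro_p (p : nat) (G : topologicalGroupType) : Prop :=
  profinite G /\
  forall N : subgroup G, open (N : set G) -> normal_subgroup N ->
    exists n : nat, has_index [set: G] N (p ^ n).

Definition topologically_boundedly_generated (G : topologicalGroupType) : Prop :=
  exists s : seq G,
    \big[@setM G/[set 1]]_(g <- s) closure (cyclic_set g) = [set: G].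

(* The pro-p completion and the pushout are given by their universal
   properties; both exist and are unique up to a unique isomorphism. *)
Definition is_pro_p_completion (p : nat) (G : groupType)
    (P : topologicalGroupType) (rho : {ghom G -> P}) : Prop :=
  pro_p p P /\
  forall (Q : topologicalGroupType) (f : {ghom G -> Q}),
    pro_p p Q ->
    exists phi : {ghom P -> Q},
      [/\ continuous phi, phi \o rho =1 f &
        forall psi : {ghom P -> Q},
          continuous psi -> psi \o rho =1 f -> psi =1 phi].

Definition is_pro_p_pushout (p : nat) (B V1 V2 Q : topologicalGroupType)
    (b1 : {ghom B -> V1}) (b2 : {ghom B -> V2})
    (j1 : {ghom V1 -> Q}) (j2 : {ghom V2 -> Q}) : Prop :=
  [/\ [/\ pro_p p B, pro_p p V1, pro_p p V2 & pro_p p Q],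
      [/\ continuous b1, continuous b2, continuous j1 & continuous j2],
      j1 \o b1 =1 j2 \o b2 &
      forall (R : topologicalGroupType)
        (f1 : {ghom V1 -> R}) (f2 : {ghom V2 -> R}),
        pro_p p R -> continuous f1 -> continuous f2 ->
        f1 \o b1 =1 f2 \o b2 ->
        exists phi : {ghom Q -> R},
          [/\ continuous phi, phi \o j1 =1 f1, phi \o j2 =1 f2 &
            forall psi : {ghom Q -> R}, continuous psi ->
              psi \o j1 =1 f1 -> psi \o j2 =1 f2 -> psi =1 phi]].

Definition topological_isomorphism (G H : topologicalGroupType)
    (f : {ghom G -> H}) : Prop :=
  continuous f /\
  exists g : H -> G, [/\ continuous g, cancel f g & cancel g f].

(* Main.v *)
Require Import Defs.
From HB Require Import structures.
From mathcomp Require Import all_boot all_fingroup ssralg zmodp cyclic pgroup.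
From mathcomp Require Import zify ring.
From mathcomp Require Import boolp classical_sets functions cardinality.
From mathcomp Require Import topology.

Set Implicit Arguments.
Unset Strict Implicit.
Unset Printing Implicit Defensive.

Local Open Scope classical_set_scope.
Local Open Scope group_scope.

(** The pushout property of [P] is formal.  A pair of continuous morphisms on
    the closures [V1] and [V2] that agree on [B] restricts to a compatible pair
    on [H1] and [H2], hence extends to [Gamma] and then to the completion; it is
    recovered on [V1] and [V2] by density.  Any other pushout is isomorphic to
    [P] over [V1] and [V2], and the amalgam is proper because the two maps to
    [P] are inclusions ([completion_is_pushout], [pushout_unique]).

    For the second part, if [H1] and [H2] are boundedly generated then so are
    the compact groups [V1] and [V2].  If [B = V1] then [P = V2]; if both
    indices are 2, then [P] is an extension of a pro-2 dihedral group by [B],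
    and [P] is the product of a procyclic subgroup and [V1]
    ([dihedral_generation]).

    Conversely, suppose that [P] is a product of [d] procyclic subgroups.  Then
    every finite p-group [G] that is a quotient of [Gamma] satisfies
    |G| <= e ^ d as soon as [x ^+ e = 1] holds in [G]
    ([amalgam_quotient_bound]).  In the remaining cases this fails.  The images
    [A1], [A2], [C] of [H1], [H2], [K] in a suitable finite p-group quotient
    satisfy |G : A1| + |G : A2| < |G : C| ([index_im_lt]); in terms of the
    Bass-Serre tree, the kernel of the map from [A1 *_C A2] to [G] is then a
    free group of rank 1 + |G : C| - |G : A1| - |G : A2| >= 2.  So there is an
    extension of [G] by an elementary abelian p-group [U], again a quotient of
    [Gamma] with the same images [A1], [A2], [C], whose order grows with [G].
    The lower bound used here, |U| > |G : C| - |G : A1| - |G : A2|, comes from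
    counting Z/p-valued functions on cosets ([cover_ker_large]).  Iterating, the
    exponent grows by a factor [p] at each step, while the order is more than
    squared up to a constant ([tower_large]); the order eventually exceeds every
    fixed power of the exponent. *)

(** * Morphisms of abstract groups and amalgams *)

Definition ghom_of (G H : groupType) (f : G -> H) (fM : monoid_morphism f) :
  {ghom G -> H} := HB.pack f (isUMagmaMorphism.Build G H f fM).

Lemma ghom_corestrict (G H : groupType) (W : subgroup G) (f : {ghom H -> G}) :
  range f `<=` W -> exists g : {ghom H -> W}, @set_val G W \o g =1 f.
Proof.
move=> fW; pose g h : W := SigSub (mem_set (fW (f h) (imageT f h))).
have gM : monoid_morphism g.
  by split=> [|x y]; apply: val_inj; [exact: gmulf1|exact: gmulfM].
by exists (ghom_of gM) => h; rewrite /= set_valE.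
Qed.

Lemma set_val_inj (T : Type) (A : set T) : injective (@set_val T A).
Proof. by rewrite set_valE; exact: val_inj. Qed.

(** The universal property yields a morphism from [G] to [W]; its composite with
    the inclusion of [W] is the identity by the uniqueness half, so [W] is
    everything. *)
Lemma amalgam_ind (K H1 H2 G : groupType)
    (k1 : {ghom K -> H1}) (k2 : {ghom K -> H2})
    (i1 : {ghom H1 -> G}) (i2 : {ghom H2 -> G}) (W : subgroup G) :
  is_amalgamated_product k1 k2 i1 i2 ->
  range i1 `<=` W -> range i2 `<=` W -> [set: G] `<=` W.
Proof.
move=> [_ _ ik univ] W1 W2.
have [f1 E1] := ghom_corestrict W1; have [f2 E2] := ghom_corestrict W2.
have f12 : f1 \o k1 =1 f2 \o k2.
  move=> k; apply: set_val_inj.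
  exact: etrans (E1 _) (etrans (ik k) (esym (E2 _))).
have [phi [P1 P2 _]] := univ _ f1 f2 f12.
have [psi [_ _ uniq]] := univ _ i1 i2 ik.
have idE := uniq idfun (fun _ => erefl) (fun _ => erefl).
have phiE := uniq (@set_val G W \o phi).
move=> g _; have -> : g = set_val (phi g).
  rewrite [LHS]idE -phiE // => h.
    exact: etrans (congr1 set_val (P1 h)) (E1 h).
  exact: etrans (congr1 set_val (P2 h)) (E2 h).
by rewrite set_valE; exact/set_mem/valP.
Qed.

(** * Elementary abelian extensions of a finite quotient of an amalgam *)

Definition ghom_im (H : groupType) (gT : finGroupType) (f : {ghom H -> gT}) :
  {set gT} := finset (fun y => `[< range f y >]).

Section GhomIm.
Variables (H : groupType) (gT : finGroupType) (f : {ghom H -> gT}).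

Lemma ghom_imP y : reflect (range f y) (y \in ghom_im f).
Proof. by rewrite inE; exact: asboolP. Qed.

Lemma mem_ghom_im h : f h \in ghom_im f.
Proof. exact/ghom_imP/imageT. Qed.

Lemma ghom_im_group_set : group_set (ghom_im f).
Proof.
apply/group_setP; split; first by rewrite -(@gmulf1 _ _ f) mem_ghom_im.
move=> _ _ /ghom_imP[a _ <-] /ghom_imP[b _ <-].
by rewrite -(@gmulfM _ _ f) mem_ghom_im.
Qed.

Canonical ghom_im_group := Group ghom_im_group_set.
End GhomIm.

Lemma leq_card_fibers (T S : finType) (f : T -> S) (A : {pred T})
    (B : {pred S}) (q : nat) :
  {in A, forall x, f x \in B} ->
  (forall y, #|[pred x in A | f x == y]| <= q)%N -> (#|A| <= #|B| * q)%N.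
Proof.
move=> fAB fib; rewrite -sum1_card (partition_big f (mem B)) //=.
rewrite -sum_nat_const; apply: leq_sum => y _.
by rewrite sum1_card; exact: fib.
Qed.

Section CosetFunctions.
Variables (p : nat) (gT : finGroupType).
Hypothesis p_pr : prime p.
Import GRing.Theory.
Local Open Scope ring_scope.

(** Functions on the left cosets of [A], encoded as functions on all subsets
    that vanish off the cosets; they stand for the functions on [gT] that are
    invariant under right translation by [A]. *)
Definition coset_funs (A : {group gT}) : {pred {ffun {set gT} -> 'F_p}} :=
  pffun_on 0 (mem (lcosets A [set: gT]%G)) predT.

Lemma card_coset_funs (A : {group gT}) :
  #|coset_funs A| = (p ^ #|[set: gT]%G : A|)%N.
Proof. by rewrite card_pffun_on card_Fp // card_lcosets. Qed.

Lemma coset_fun_of (A : {group gT}) (a : gT -> 'F_p) :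
  (forall x g, g \in A -> a (x * g)%g = a x) ->
  exists2 f, f \in coset_funs A & forall x, f (x *: A)%g = a x.
Proof.
move=> aA; exists [ffun D : {set gT} =>
  if D \in lcosets A [set: gT]%G then a (repr D) else 0].
  apply/pffun_onP; split=> //; apply/fintype.subsetP=> D; rewrite inE /= ffunE.
  by case: ifP => //; rewrite eqxx.
move=> x; rewrite ffunE (_ : _ \in _); last first.
  by apply/lcosetsP; exists x; rewrite ?inE.
by have /lcosetP[g Ag ->] := mem_repr _ (lcoset_refl A x); rewrite aA.
Qed.

End CosetFunctions.

Section Twist.
Variables (p : nat) (gT : finGroupType) (I : finType) (M : I -> gT -> 'F_p).
Import GRing.Theory.
Local Notation X := (I * gT * 'F_p)%type.

(** [gT] acts on the right on the trivial Z/p-bundle over [I * gT] by right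
    translation, conjugated by the fibrewise shift [t + M m x]. *)
Definition twist_fun (g : gT) (z : X) : X :=
  (z.1.1, z.1.2 * g, (z.2 + M z.1.1 (z.1.2 * g)%g - M z.1.1 z.1.2)%R).

Lemma twist_fun_inj g : injective (twist_fun g).
Proof.
move=> [[m x] t] [[m' x'] t'] E.
have [mE /mulIg xE] : m = m' /\ x * g = x' * g.
  by split; [exact: (congr1 (fst \o fst) E)|exact: (congr1 (snd \o fst) E)].
by move: (congr1 snd E); rewrite /= -mE -xE => /addIr/addIr ->.
Qed.

Definition twist g : {perm X} := perm (@twist_fun_inj g).

Lemma twistE g m x t :
  twist g (m, x, t) = (m, x * g, (t + M m (x * g)%g - M m x)%R).
Proof. by rewrite permE. Qed.

Lemma twist_monoid_morphism : monoid.monoid_morphism twist.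
Proof.
split=> [|g h]; apply/permP=> -[[m x] t]; rewrite twistE ?permM ?perm1.
  by rewrite mulg1 addrK.
rewrite !twistE mulgA; congr (_, _, _).
by rewrite [RHS]addrAC (addrAC t (M m (x * g)%g)) addrK [RHS]addrAC.
Qed.

Definition twist_ghom : {ghom gT -> {perm X}} := ghom_of twist_monoid_morphism.

End Twist.

Section ElementaryCover.
Variables (p : nat) (K H1 H2 Gamma : groupType).
Variables (k1 : {ghom K -> H1}) (k2 : {ghom K -> H2}).
Variables (i1 : {ghom H1 -> Gamma}) (i2 : {ghom H2 -> Gamma}).
Hypothesis p_pr : prime p.
Hypothesis amalg : is_amalgamated_product k1 k2 i1 i2.
Variables (gT : finGroupType) (pi : {ghom Gamma -> gT}).
Hypothesis pi_onto : forall x, exists g, pi g = x.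
Import GRing.Theory.

Let A1 := ghom_im_group (pi \o i1).
Let A2 := ghom_im_group (pi \o i2).
Let C := ghom_im_group (pi \o (i1 \o k1)).

Local Notation J := {ffun {set gT} -> 'F_p}.
Local Notation X := (J * gT * 'F_p)%type.

(** [H1] acts by plain translation and [H2] by the action conjugated by the
    shift [m (x C)], with all coset functions [m] treated simultaneously.  The
    shift is constant along [K]-orbits, so the two actions agree on [K]. *)
Lemma elementary_cover_action : exists phi : {ghom Gamma -> {perm X}},
  (forall h m x t, phi (i1 h) (m, x, t) = (m, x * pi (i1 h), t)) /\
  (forall h (m : J) x t, phi (i2 h) (m, x, t) = (m, x * pi (i2 h),
     (t + m (x * pi (i2 h) *: C)%g - m (x *: C)%g)%R)).
Proof.
pose M0 (m : J) (x : gT) : 'F_p := 0%R.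
pose M (m : J) (x : gT) : 'F_p := m (x *: C).
pose f1 : {ghom H1 -> {perm X}} := twist_ghom M0 \o (pi \o i1).
pose f2 : {ghom H2 -> {perm X}} := twist_ghom M \o (pi \o i2).
case: amalg => _ _ ik univ.
have f12 : f1 \o k1 =1 f2 \o k2.
  move=> k; apply/permP=> -[[m x] t]; rewrite /= !twistE /M0 addr0 subr0.
  have <- : i1 (k1 k) = i2 (k2 k) by exact: ik.
  rewrite /M [in X in _ = (_, _, X)](_ : _ *: _ = x *: C) ?addrK //.
  by rewrite lcosetM lcoset_id //; exact: (mem_ghom_im (pi \o (i1 \o k1))).
have [phi [E1 E2 _]] := univ _ f1 f2 f12.
exists phi; split=> h m x t.
  have -> : phi (i1 h) = f1 h by exact: E1.
  by rewrite /= twistE /M0 addr0 subr0.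
have -> : phi (i2 h) = f2 h by exact: E2.
by rewrite /= twistE.
Qed.

Section Shift.
Variable phi : {ghom Gamma -> {perm X}}.
Hypothesis phi1 : forall h (m : J) x t,
  phi (i1 h) (m, x, t) = (m, x * pi (i1 h), t).
Hypothesis phi2 : forall h (m : J) x t, phi (i2 h) (m, x, t) =
  (m, x * pi (i2 h), (t + m (x * pi (i2 h) *: C)%g - m (x *: C)%g)%R).

Lemma cover_shift_exists g : exists d : J -> gT -> 'F_p,
  forall m x t, phi g (m, x, t) = (m, x * pi g, (t + d m x)%R).
Proof.
pose Q : set Gamma := [set g | exists d : J -> gT -> 'F_p,
  forall m x t, phi g (m, x, t) = (m, x * pi g, (t + d m x)%R)].
have Q1 : Q 1.
  by exists (fun _ _ => 0%R) => m x t; rewrite !gmulf1 perm1 mulg1 addr0.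
have QF a b : Q a -> Q b -> Q (a * b^-1).
  move=> [d dE] [e eE].
  exists (fun m x => (d m x - e m (x * pi a * (pi b)^-1)%g)%R) => m x t.
  rewrite !gmulfM !gmulfV permM dE; apply: (canLR (permK _)).
  by rewrite eE mulgA mulgKV addrA subrK.
pose W := Subgroup Q1 QF.
have /(_ g I) : [set: Gamma] `<=` W; last by [].
apply: (amalgam_ind amalg) => _ [h _ <-].
  by exists (fun _ _ => 0%R) => m x t; rewrite phi1 addr0.
exists (fun m x => (m (x * pi (i2 h) *: C)%g - m (x *: C)%g)%R) => m x t.
by rewrite phi2 addrA.
Qed.

Definition cover_shift g (m : J) x : 'F_p := (phi g (m, x, 0%R)).2.
Local Notation d := cover_shift.

Lemma cover_shiftE g m x t :
  phi g (m, x, t) = (m, x * pi g, (t + d g m x)%R).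
Proof.
by have [e eE] := cover_shift_exists g; rewrite /d !eE /= add0r.
Qed.

Lemma cover_shiftM g h m x : d (g * h) m x = (d g m x + d h m (x * pi g)%g)%R.
Proof. by rewrite {1}/d gmulfM permM !cover_shiftE /= add0r. Qed.

Lemma cover_shift1 h m x : d (i1 h) m x = 0%R.
Proof. by rewrite /d phi1. Qed.

Lemma cover_shift2 h m x :
  d (i2 h) m x = (m (x * pi (i2 h) *: C)%g - m (x *: C)%g)%R.
Proof. by rewrite /d phi2 /= add0r. Qed.

Lemma cover_pi g h : phi g = phi h -> pi g = pi h.
Proof.
move=> E; have: phi g (0%R, 1%g, 0%R) = phi h (0%R, 1%g, 0%R) by rewrite E.
by rewrite !cover_shiftE => /(congr1 (snd \o fst))/mulgI.
Qed.

Definition cover_ker : {set {perm X}} :=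
  finset (fun s => `[< exists2 g, pi g = 1 & phi g = s >]).
Local Notation U := cover_ker.

Lemma cover_kerP s : reflect (exists2 g, pi g = 1 & phi g = s) (s \in U).
Proof. by rewrite inE; exact: asboolP. Qed.

(** [phi g ^+ e] lies in the kernel, whose elements are fibrewise translations
    of Z/p. *)
Lemma cover_exponent e : (forall x : gT, x ^+ e = 1) ->
  forall g, phi g ^+ (p * e) = 1.
Proof.
move=> expT g; rewrite mulnC expgnA -!gmulfXn.
set h := g ^+ e; have pih : pi h = 1 by rewrite gmulfXn expT.
have phiX n m x t : (phi h ^+ n) (m, x, t) = (m, x, (t + d h m x *+ n)%R).
  elim: n => [|n IH]; first by rewrite expg0 perm1 mulr0n addr0.
  by rewrite expgSr permM IH cover_shiftE pih mulg1 -addrA -mulrSr.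
apply/permP=> -[[m x] t]; rewrite gmulfXn phiX perm1.
by rewrite -mulr_natr pchar_Fp_0 // mulr0 addr0.
Qed.

Lemma card_cover : #|ghom_im phi| = (#|gT| * #|U|)%N.
Proof.
have [r rK] := choice pi_onto.
pose f (z : gT * {perm X}) := z.2 * phi (r z.1).
have -> : ghom_im phi = f @: (finset.setX [set: gT]%SET U).
  apply/setP=> s; apply/ghom_imP/imsetP => [[g _ <-]|[[x u]]].
    exists (pi g, phi (g * (r (pi g))^-1)).
      rewrite finset.in_setX inE /=; apply/cover_kerP.
      exists (g * (r (pi g))^-1) => //.
      by rewrite gmulfM gmulfV rK mulgV.
    by rewrite /f /= -gmulfM mulgVK.
  rewrite finset.in_setX => /andP[_ /cover_kerP[g _ <-]] ->.
  by exists (g * r x) => //; rewrite gmulfM.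
rewrite card_in_imset ?cardsX ?cardsT // => -[x u] [y v].
rewrite !finset.in_setX => /andP[_ /cover_kerP[g pg <-]].
move=> /andP[_ /cover_kerP[h ph <-]].
rewrite /f /= -!gmulfM => E; have := cover_pi E.
rewrite !gmulfM pg ph !mul1g !rK => xy; move: E.
by rewrite xy !gmulfM => /mulIg ->.
Qed.

(** The kernel of the extension fixes the point 1 of the base, and moves the
    fibre over it by a homomorphism to Z/p. *)
Definition cover_char (m : J) : {ffun {perm X} -> 'F_p} :=
  [ffun s : {perm X} => if s \in U then (s (m, 1%g, 0%R)).2 else 0%R].

(** If [m] and [m'] induce the same character of the kernel, the difference of
    the shifts along [g] depends on [pi g] only, which defines [a] on [gT].
    Following [H1] the shifts vanish, so [a] is right [A1]-invariant; following
    [H2] they are coboundaries of [m] and [m'], so [a] minus [m' - m] is right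
    [A2]-invariant. *)
Lemma cover_char_same m m' : cover_char m = cover_char m' ->
  exists a b : gT -> 'F_p,
  [/\ forall x g, g \in A1 -> a (x * g)%g = a x,
      forall x g, g \in A2 -> b (x * g)%g = b x &
      forall x, m' (x *: C) = (m (x *: C)%g + a x - b x)%R].
Proof.
move=> mm'; have [r rK] := choice pi_onto.
pose f g := (d g m' 1%g - d g m 1%g)%R.
have fE g h : pi g = pi h -> f g = f h.
  move=> gh; have pu : pi (g * h^-1) = 1 by rewrite gmulfM gmulfV gh mulgV.
  have Uu : phi (g * h^-1) \in U by apply/cover_kerP; exists (g * h^-1).
  have dE : d (g * h^-1) m 1%g = d (g * h^-1) m' 1%g.
    have := congr1 (fun l : {ffun _} => l (phi (g * h^-1))) mm'.
    by rewrite /= !ffunE Uu.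
  rewrite -{1}(mulgVK h g) /f !(cover_shiftM (g * h^-1) h) pu mulg1 dE.
  by rewrite opprD addrACA subrr add0r.
pose a x := f (r x); exists a.
exists (fun x => (a x - (m' (x *: C)%g - m (x *: C)%g))%R).
have fr g x : f (r (x * pi g)) = f (r x * g).
  by apply: fE; rewrite gmulfM !rK.
split=> [x _ /ghom_imP[h _ <-]|x _ /ghom_imP[h _ <-]|x].
- by rewrite /a fr /f !cover_shiftM !cover_shift1 !addr0.
- rewrite /a fr /f !cover_shiftM !cover_shift2 mul1g rK.
  set u := d _ m' _; set v := d _ m _; set M' := m' _; set M := m _.
  set N' := m' _; set N := m _.
  ring.
- by ring.
Qed.

(** By [cover_char_same], two elements of a fibre differ by the sum of an
    [A1]-invariant and an [A2]-invariant function. *)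
Lemma cover_char_fiber y :
  (#|[pred m in coset_funs (p := p) C | cover_char m == y]|
    <= p ^ #|[set: gT]%G : A1| * p ^ #|[set: gT]%G : A2|)%N.
Proof.
set F := [pred m in _ | _].
have [m0|F0] := pickP F; last by rewrite eq_card0.
rewrite inE => /andP[_ /eqP my].
pose comb (ab : J * J) : J := [ffun D : {set gT} =>
  if D \in lcosets C [set: gT]%G then
    (m0 D + ab.1 (repr D *: A1)%g - ab.2 (repr D *: A2)%g)%R else 0%R].
pose R := [pred ab : J * J | (ab.1 \in coset_funs A1) && (ab.2 \in coset_funs A2)].
have -> : (p ^ #|[set: gT]%G : A1| * p ^ #|[set: gT]%G : A2|)%N = #|R|.
  by rewrite -!card_coset_funs // -cardX.
apply: leq_trans (leq_image_card comb R); apply: subset_leq_card.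
apply/fintype.subsetP => m; rewrite inE => /andP[Cm /eqP my'].
have [a [b [aA bA mE]]] := cover_char_same (etrans my (esym my')).
have [a' a'A aE] := coset_fun_of aA.
have [b' b'A bE] := coset_fun_of bA.
apply/fintype.imageP; exists (a', b'); first by rewrite inE /= a'A b'A.
apply/ffunP=> D; rewrite ffunE; case: ifP => [/lcosetsP[x _ Dx]|CD].
  have DE : repr D *: C = D.
    by rewrite {2}Dx; apply/lcoset_eqP; rewrite Dx (mem_repr x) ?lcoset_refl.
  by rewrite /= aE bE -[in LHS]DE mE DE.
apply/eqP/negPn/negP => mD; case/pffun_onP: Cm => /fintype.subsetP/(_ D).
by rewrite !inE CD => /(_ mD).
Qed.

(** There are [p ^ |G : C|] coset functions, at most [p ^ (|U| - 1)] characters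
    because a character vanishes at 1, and at most [p ^ (|G : A1| + |G : A2|)]
    coset functions for each character. *)
Lemma cover_ker_large :
  (#|[set: gT]%G : C| < #|U| + #|[set: gT]%G : A1| + #|[set: gT]%G : A2|)%N.
Proof.
have U1 : 1 \in U.
  by apply/cover_kerP; exists 1; rewrite gmulf1.
have inB : {in coset_funs (p := p) C, forall m, cover_char m \in
    pffun_on (0%R : 'F_p) (mem (U :\ (1 : {perm X}))) predT}.
  move=> m _; apply/pffun_onP; split=> //; apply/fintype.subsetP => s.
  rewrite !inE /= ffunE; have [->|_] := eqVneq s 1.
    by rewrite perm1; case: ifP; rewrite eqxx.
  by case: ifP => [|_ /eqP //]; rewrite inE => ->.
have := leq_card_fibers inB cover_char_fiber.
rewrite card_coset_funs // card_pffun_on card_Fp // -!expnD.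
rewrite leq_exp2l ?prime_gt1 // (cardsD1 1 U) U1 add1n !addSn ltnS.
by rewrite addnA.
Qed.
End Shift.
End ElementaryCover.

(** * Growth of finite p-quotients of an amalgam *)

Lemma card_ghom_im_eq (H : groupType) (gT gT' : finGroupType)
    (f : {ghom H -> gT}) (f' : {ghom H -> gT'}) :
  (forall x y, f x = f y <-> f' x = f' y) -> #|ghom_im f| = #|ghom_im f'|.
Proof.
suff leq_im (rT rT' : finGroupType) (q : {ghom H -> rT}) (q' : {ghom H -> rT'}) :
    (forall x y, q x = q y <-> q' x = q' y) -> (#|ghom_im q| <= #|ghom_im q'|)%N.
  move=> E; apply/eqP; rewrite eqn_leq !leq_im // => x y.
  by split=> /E.
move=> E; have [r rK] : {r : rT -> H & forall y, y \in ghom_im q -> q (r y) = y}.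
  apply: (choice (P := fun y h => y \in ghom_im q -> q h = y)) => y.
  have [/ghom_imP[h _ <-]|qy] := boolP (y \in ghom_im q).
    by exists h.
  by exists 1.
rewrite -(card_in_imset (f := q' \o r) (D := ghom_im q)).
  by apply/subset_leq_card/fintype.subsetP => _ /imsetP[y _ ->]; exact: mem_ghom_im.
by move=> x y xq yq /= /E; rewrite !rK.
Qed.

Lemma ghom_onto_im (H : groupType) (gT : finGroupType) (f : {ghom H -> gT}) :
  exists (qT : finGroupType) (q : {ghom H -> qT}),
    (forall x, exists h, q h = x) /\ (forall x y, q x = q y <-> f x = f y).
Proof.
pose S := ghom_im_group f.
have fS h : f h \in S by exact: mem_ghom_im.
pose q h : subg_of S := Subg (fS h).
have qM : monoid.monoid_morphism q.
  by split=> [|x y]; apply: val_inj; [exact: gmulf1|exact: gmulfM].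
exists (subg_of S), (ghom_of qM); split=> [[x Sx]|x y].
  by have /ghom_imP[h _ hx] := Sx; exists h; apply: val_inj.
by split=> [/(congr1 val)|xy]; last exact: val_inj.
Qed.

Lemma card_ghom_im_onto (H : groupType) (gT : finGroupType) (f : {ghom H -> gT}) :
  (forall x, exists h, f h = x) -> #|ghom_im f| = #|gT|.
Proof.
move=> f_onto; rewrite -cardsT; apply: eq_card => x; rewrite finset.in_setT.
by have [h <-] := f_onto x; rewrite mem_ghom_im.
Qed.

Section Growth.
Variables (p : nat) (K H1 H2 Gamma : groupType).
Variables (k1 : {ghom K -> H1}) (k2 : {ghom K -> H2}).
Variables (i1 : {ghom H1 -> Gamma}) (i2 : {ghom H2 -> Gamma}).
Hypothesis p_pr : prime p.
Hypothesis amalg : is_amalgamated_product k1 k2 i1 i2.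

Local Notation onto q := (forall x, exists g, q g = x).
Local Notation index_im q := #|[set: _]%G : ghom_im_group q|.

(** The vertex groups keep their images: over [H1] the action is a translation,
    and over [H2] it is conjugate to one, so both kernels are those of [pi]. *)
Lemma elementary_cover (gT : finGroupType) (pi : {ghom Gamma -> gT}) :
  onto pi -> exists (gT' : finGroupType) (pi' : {ghom Gamma -> gT'}) (u : nat),
  [/\ onto pi', #|gT'| = (#|gT| * u)%N,
      (index_im (pi \o (i1 \o k1)) <
        u + index_im (pi \o i1) + index_im (pi \o i2))%N,
      forall e, (forall x : gT, x ^+ e = 1) -> forall x : gT', x ^+ (p * e) = 1 &
      [/\ #|ghom_im (pi' \o i1)| = #|ghom_im (pi \o i1)|,
        #|ghom_im (pi' \o i2)| = #|ghom_im (pi \o i2)| &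
        #|ghom_im (pi' \o (i1 \o k1))| = #|ghom_im (pi \o (i1 \o k1))|]].
Proof.
move=> pi_onto.
have [phi [phi1 phi2]] := elementary_cover_action p amalg pi.
have [gT' [pi' [pi'_onto pi'E]]] := ghom_onto_im phi.
have ker1 x y : pi' (i1 x) = pi' (i1 y) <-> pi (i1 x) = pi (i1 y).
  rewrite pi'E; split; first exact: (cover_pi amalg phi1 phi2).
  by move=> xy; apply/permP=> -[[m z] t]; rewrite !phi1 xy.
have ker2 x y : pi' (i2 x) = pi' (i2 y) <-> pi (i2 x) = pi (i2 y).
  rewrite pi'E; split; first exact: (cover_pi amalg phi1 phi2).
  by move=> xy; apply/permP=> -[[m z] t]; rewrite !phi2 xy.
exists gT', pi', #|cover_ker pi phi|; split=> //.
- rewrite -(card_cover amalg pi_onto phi1 phi2) -(card_ghom_im_onto pi'_onto).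
  exact: card_ghom_im_eq.
- exact: (cover_ker_large p_pr amalg pi_onto phi1 phi2).
- move=> e expT x; have [g <-] := pi'_onto x.
  rewrite -gmulfXn -(@gmulf1 _ _ pi'); apply/pi'E.
  by rewrite gmulfXn gmulf1 (cover_exponent p_pr amalg phi1 phi2).
- by split; apply: card_ghom_im_eq => x y; [exact: ker1|exact: ker2|exact: ker1].
Qed.

Section Iteration.
Variables (gT0 : finGroupType) (pi0 : {ghom Gamma -> gT0}) (e0 : nat).
Hypothesis pi0_onto : onto pi0.
Hypothesis expT0 : forall x : gT0, x ^+ e0 = 1.
Hypothesis index_lt : (index_im (pi0 \o i1) + index_im (pi0 \o i2) <
  index_im (pi0 \o (i1 \o k1)))%N.

(** A finite quotient of order [h] times that of [gT0], obtained after [k]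
    extensions; the images of the vertex and edge groups stay those in [gT0]. *)
Definition tower (k h : nat) : Prop :=
  exists (gT : finGroupType) (pi : {ghom Gamma -> gT}),
  [/\ onto pi, #|gT| = (h * #|gT0|)%N,
      forall x : gT, x ^+ (p ^ k * e0) = 1 &
      [/\ #|ghom_im (pi \o i1)| = #|ghom_im (pi0 \o i1)|,
        #|ghom_im (pi \o i2)| = #|ghom_im (pi0 \o i2)| &
        #|ghom_im (pi \o (i1 \o k1))| = #|ghom_im (pi0 \o (i1 \o k1))|]].

Lemma tower0 : tower 0 1.
Proof. by exists gT0, pi0; split=> //; rewrite ?mul1n ?expn0. Qed.

Lemma index_im_tower (H : groupType) (f : {ghom H -> Gamma}) (gT : finGroupType)
    (pi : {ghom Gamma -> gT}) h :
  #|gT| = (h * #|gT0|)%N -> #|ghom_im (pi \o f)| = #|ghom_im (pi0 \o f)| ->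
  index_im (pi \o f) = (h * index_im (pi0 \o f))%N.
Proof.
move=> cT cf; have := Lagrange (finset.subsetT (ghom_im_group (pi \o f))).
have := Lagrange (finset.subsetT (ghom_im_group (pi0 \o f))).
rewrite !cardsT /= cT cf => <-; rewrite mulnCA => /eqP.
by rewrite eqn_pmul2l ?(cardG_gt0 (ghom_im_group (pi0 \o f))) // => /eqP.
Qed.

(** The images of [H1], [H2] and [K] being fixed, the three indices scale by
    [h], so their integral excess is at least [h], which bounds the new kernel
    from below. *)
Lemma towerS k h : tower k h -> exists2 h', (h * h.+1 <= h')%N & tower k.+1 h'.
Proof.
move=> [gT [pi [pi_onto cT expT [c1 c2 c]]]].
have [gT' [pi' [u [pi'_onto cT' lt_u exp' [c1' c2' c']]]]] :=
  elementary_cover pi_onto.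
exists (h * u)%N; last first.
  exists gT', pi'; split; rewrite ?c1' ?c2' ?c' ?cT' ?cT ?mulnA //.
    by rewrite mulnAC.
  by rewrite expnS -mulnA; exact: exp'.
rewrite leq_mul2l; apply/orP; right.
move: lt_u; rewrite !(index_im_tower cT) //.
move: index_lt; move: (index_im _) (index_im _) (index_im _) => a b d; nia.
Qed.

(** The recursion [h * h.+1 <= h'] starts at [h = 1], where squaring gives
    nothing; one step gives 2, and from there on the order at least squares. *)
Lemma tower_large k : exists2 h, (2 ^ 2 ^ k <= h)%N & tower k.+1 h.
Proof.
elim: k => [|k [h le_h /towerS[h' le_h' T]]].
  by have [h le_h T] := towerS tower0; exists h.
exists h' => //; apply: leq_trans le_h'; rewrite expnS mulnC expnM.
by rewrite expnS expn1 leq_mul // leqW.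
Qed.

Lemma double_exp_wins c d : exists k, ((2 ^ (c * k.+1)) ^ d < 2 ^ 2 ^ k)%N.
Proof.
(* [2 ^ (4 * n) >= (2 * n).+1 ^ 2 > n * (4 * n).+1]. *)
pose n := (c * d)%N; exists (4 * n)%N; rewrite -expnM ltn_exp2l //.
have lt2 m : (m < 2 ^ m)%N by exact: ltn_expl.
have -> : (4 * n = 2 * n + 2 * n)%N by lia.
rewrite expnD; apply: (@leq_trans ((2 * n).+1 * (2 * n).+1)); last exact: leq_mul.
by rewrite /n; nia.
Qed.

Lemma amalgam_large_quotient d : exists (gT : finGroupType)
  (pi : {ghom Gamma -> gT}) (k : nat),
  [/\ onto pi, forall x : gT, x ^+ (p ^ k * e0) = 1 &
      ((p ^ k * e0) ^ d < #|gT|)%N].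
Proof.
have [k lt_k] := double_exp_wins (p + e0) d.
have [h le_h [gT [pi [pi_onto cT expT _]]]] := tower_large k.
exists gT, pi, k.+1; split=> //; rewrite cT.
apply: leq_trans (leq_pmulr h _); last by apply/card_gt0P; exists 1.
apply: leq_trans le_h; apply: leq_ltn_trans lt_k.
have le2 m : (m <= 2 ^ m)%N by exact/ltnW/ltn_expl.
case: d => [|d]; first by rewrite !expn0.
rewrite leq_exp2r // mulnDl expnD leq_mul //.
  by rewrite expnM leq_exp2r.
by apply: leq_trans (le2 _) _; rewrite leq_exp2l // leq_pmulr.
Qed.

End Iteration.
End Growth.

(** * Compact totally disconnected spaces are zero-dimensional *)

Section QuasiComponents.
Variable T : topologicalType.
Hypothesis cptT : compact [set: T].
Hypothesis hsdT : hausdorff_space T.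

Definition quasi_component (x : T) : set T :=
  \bigcap_(C in [set C : set T | clopen C /\ C x]) C.

(** Otherwise the traces on [K] of the clopen neighbourhoods of [x] form a
    proper filter, and a cluster point of it lies in all of these closed
    neighbourhoods. *)
Lemma quasi_component_clopen x (K : set T) :
  compact K -> quasi_component x `&` K = set0 ->
  exists C, [/\ clopen C, C x & C `&` K = set0].
Proof.
move=> cptK QK; apply: contrapT => noC.
pose D := [set C : set T | clopen C /\ C x].
pose G := filter_from D (fun C => C `&` K).
have GF : Filter G.
  apply: filter_from_filter; first by exists setT; split=> //; exact: clopenT.
  move=> A B [cA Ax] [cB Bx]; exists (A `&` B); first by split=> //; exact: clopenI.
  by move=> y [[Ay By] Ky].
have GP : ProperFilter G.
  apply: filter_from_proper => C [cC Cx]; apply/set0P/eqP => CK0.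
  by apply: noC; exists C.
have GK : G K by exists setT; [split=> //; exact: clopenT|move=> y []].
have [z [Kz clz]] := cptK G GP GK.
suff : (quasi_component x `&` K) z by rewrite QK.
split=> // C [[oC cC] Cx]; apply: contrapT => nCz.
have [y [[Cy _] /(_ Cy)]] : (C `&` K) `&` ~` C !=set0; last by [].
apply: clz; first by exists C.
by apply: open_nbhs_nbhs; split=> //; exact: closed_openC.
Qed.

Lemma quasi_component_closed x : closed (quasi_component x).
Proof. by apply: closed_bigI => C [[]]. Qed.

(** By normality [S] has an open neighbourhood [W] whose closure misses [S'];
    the boundary of [W] is compact and misses the quasi-component, so some
    clopen neighbourhood [C] of [x] misses the boundary.  Then [C `&` W] is
    clopen and contains the whole quasi-component. *)
Lemma quasi_component_unsplit x (S S' : set T) : closed S -> closed S' ->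
  S `&` S' = set0 -> S `|` S' = quasi_component x -> S x -> S' = set0.
Proof.
move=> cS cS' SS' QE Sx.
have /(_ S cS (~` S')) : normal_space T by exact: compact_normal.
have nS : set_nbhs S (~` S').
  move=> y Sy; apply: open_nbhs_nbhs; split; first exact: closed_openC.
  by move=> S'y; suff : (S `&` S') y by rewrite SS'.
move=> /(_ nS)[U nU UW]; pose W := U°.
have oW : open W by exact: open_interior.
have SW : S `<=` W by move=> y /nU.
have WU : closure W `<=` closure U by apply: closureS; exact: interior_subset.
have cptK : compact (closure W `\` W).
  apply: (subclosed_compact _ cptT) => //.
  by apply: closedI; [exact: closed_closure|exact: open_closedC].
have [|C [[oC cC] Cx CK]] := quasi_component_clopen cptK (x := x).
  rewrite -QE; apply/seteqP; split=> // y [[Sy|S'y] [cWy nWy]].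
    exact/nWy/SW.
  exact: (UW y (WU y cWy)).
have CW : clopen (C `&` W).
  split; first exact: openI.
  suff -> : C `&` W = C `&` closure W by apply: closedI => //; exact: closed_closure.
  apply/seteqP; split=> y [Cy Wy]; split=> //; first exact: subset_closure.
  apply: contrapT => nWy; suff : (C `&` (closure W `\` W)) y by rewrite CK.
  by [].
apply/seteqP; split=> // y S'y.
have Qy : quasi_component x y by rewrite -QE; right.
have [//|_ Wy] := Qy (C `&` W); first by split=> //; split=> //; exact: SW.
by apply: (UW y) => //; apply/WU/subset_closure.
Qed.

Lemma quasi_component_connected x : connected (quasi_component x).
Proof.
set Q := quasi_component x; have cQ := @quasi_component_closed x.
move=> B B0 [O oO BO] [F cF BF].
have cB : closed B by rewrite BF; exact: closedI.
have cA : closed (Q `&` ~` O) by apply: closedI => //; exact: open_closedC.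
have AB : B `&` (Q `&` ~` O) = set0.
  by rewrite BO; apply/seteqP; split=> // y [[_ Oy] [_]].
have ABE : B `|` (Q `&` ~` O) = Q by rewrite BO -setIUr setUv setIT.
have Qx : Q x by move=> C [].
move: (Qx); rewrite -{1}ABE => -[Bx|Ax].
  have A0 := quasi_component_unsplit cB cA AB ABE Bx.
  by rewrite -[RHS]ABE A0 setU0.
have := quasi_component_unsplit cA cB _ _ Ax; rewrite setIC setUC => /(_ AB ABE).
by move=> B00; case: B0 => y; rewrite B00.
Qed.

Lemma compact_zero_dimensional :
  totally_disconnected [set: T] -> zero_dimensional T.
Proof.
move=> tdT x y xy; apply: contrapT => nC.
have Qy : quasi_component x y.
  by move=> C [cC Cx]; apply: contrapT => nCy; apply: nC; exists C.
have : connected_component [set: T] x y.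
  exists (quasi_component x) => //; split=> //.
  - by move=> C [].
  - exact: quasi_component_connected.
by rewrite tdT // => yx; rewrite yx eqxx in xy.
Qed.

End QuasiComponents.

(** * Open normal subgroups and indices *)

Section TopologicalGroups.
Variable P : topologicalGroupType.

Lemma mulg_continuous2 (T : topologicalType) (f g : T -> P) x :
  {for x, continuous f} -> {for x, continuous g} ->
  {for x, continuous (fun y => f y * g y)}.
Proof.
move=> cf cg; apply: (@continuous_comp _ _ _ (fun y => (f y, g y))
  (fun z : P * P => z.1 * z.2)); last exact: mulg_continuous.
exact: cvg_pair.
Qed.

Lemma profinite_zero_dimensional : profinite P -> zero_dimensional P.
Proof. by case=> cptP hsdP tdP; exact: compact_zero_dimensional. Qed.

(** For a clopen [K] with [1 \in K] inside [W], the elements that may be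
    inserted anywhere in a product without changing its membership in [K] form
    a normal subgroup (the kernel of the syntactic congruence of [K]); it is
    open by compactness of [P * P]. *)
Lemma profinite_open_normal (W : set P) : profinite P -> nbhs 1 W ->
  exists N : subgroup P, [/\ open (N : set P), normal_subgroup N & N `<=` W].
Proof.
move=> proP nW; have [cptP hsdP tdP] := proP.
have [K [K1 [oK cK]] KW] := zero_dimensional_cvg hsdP
  (profinite_zero_dimensional proP) cptP nW.
pose Q : set P := [set n | forall x y, K (x * n * y) <-> K (x * y)].
have Q1 : Q 1 by move=> x y; rewrite mulg1.
have QF a b : Q a -> Q b -> Q (a * b^-1).
  move=> Qa Qb x y; rewrite mulgA -(Qb (x * a * b^-1) y).
  by rewrite -(mulgA (x * a)) mulVg mulg1.
exists (Subgroup Q1 QF); split.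
- rewrite openE => n Qn; rewrite /interior /=.
  pose R (m : P) (z : P * P) := K (z.1 * m * z.2) <-> K (z.1 * z.2).
  have cptPP : compact [set: P * P].
    by rewrite -setXTT; exact: compact_setX.
  move/compact_near_coveringP: cptPP => /(_ _ (nbhs n) R).
  have cfst (z : P * P) m : {for (z, m), continuous (fun w : (P * P) * P => w.1.1)}.
    by apply: (@continuous_comp _ _ _ fst fst); exact: cvg_fst.
  have csnd (z : P * P) m : {for (z, m), continuous (fun w : (P * P) * P => w.1.2)}.
    by apply: (@continuous_comp _ _ _ fst snd); [exact: cvg_fst|exact: cvg_snd].
  have cont3 (z : P * P) :
      {for (z, n), continuous (fun w : (P * P) * P => w.1.1 * w.2 * w.1.2)}.
    apply: mulg_continuous2 => //; apply: mulg_continuous2 => //; exact: cvg_snd.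
  have cont2 (z : P * P) :
      {for (z, n), continuous (fun w : (P * P) * P => w.1.1 * w.1.2)}.
    exact: mulg_continuous2.
  have loc (L : set P) (z : P * P) : open L -> L (z.1 * n * z.2) -> L (z.1 * z.2) ->
      \forall z' \near z & m \near n, L (z'.1 * m * z'.2) /\ L (z'.1 * z'.2).
    move=> oL L3 L2.
    have n3 := cont3 z L (open_nbhs_nbhs (conj oL L3)).
    have n2 := cont2 z L (open_nbhs_nbhs (conj oL L2)).
    exact: (@filterI _ (nbhs (z, n)) _ _ _ n3 n2).
  have Rnear z : [set: P * P] z -> \forall z' \near z & m \near n, R m z'.
    move=> _; have [Kz|nKz] := pselect (K (z.1 * z.2)).
      have := loc K z oK ((Qn _ _).2 Kz) Kz.
      by apply: filterS => w [].
    have nKn : ~ K (z.1 * n * z.2) by move/Qn.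
    have := loc (~` K) z (closed_openC cK) nKn nKz.
    by apply: filterS => w [].
  move=> /(_ _ Rnear); apply: filterS => m Rm x y.
  exact: (Rm (x, y)).
- move=> g _ [n Qn <-] x y.
  have -> : x * n ^ g * y = x * g^-1 * n * (g * y) by rewrite conjgE !mulgA.
  by rewrite (Qn (x * g^-1)) mulgA mulgVK.
- by move=> n Qn; apply: KW; have := Qn 1 1; rewrite !mulg1 mul1g => ->.
Qed.

End TopologicalGroups.

Lemma coset_mem (G : groupType) (N : subgroup G) (x y : G) :
  setM [set x] N y <-> (N : set G) (x^-1 * y).
Proof.
split=> [[_ -> [n Nn <-]]|Nxy]; first by rewrite mulKg.
by exists x => //; exists (x^-1 * y); rewrite ?mulVKg.
Qed.

Lemma subgroupM (G : groupType) (N : subgroup G) x y :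
  (N : set G) x -> (N : set G) y -> (N : set G) (x * y).
Proof.
move=> Nx Ny; rewrite -[y]invgK; apply: subgroupF => //.
by rewrite -[y^-1]mul1g; apply: subgroupF => //; exact: subgroup1.
Qed.

Lemma subgroupV (G : groupType) (N : subgroup G) x :
  (N : set G) x -> (N : set G) x^-1.
Proof.
by move=> Nx; rewrite -[x^-1]mul1g; apply: subgroupF => //; exact: subgroup1.
Qed.

Lemma coset_eq (G : groupType) (N : subgroup G) (x y : G) :
  setM [set x] N = setM [set y] N <-> (N : set G) (x^-1 * y).
Proof.
split=> [E|Nxy].
  apply/coset_mem; rewrite E; apply/coset_mem; rewrite mulVg.
  exact: subgroup1.
apply/seteqP; split=> z /coset_mem Nz; apply/coset_mem.
  have -> : y^-1 * z = (x^-1 * y)^-1 * (x^-1 * z).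
    by rewrite invgM invgK -mulgA mulVKg.
  by apply: subgroupM => //; exact: subgroupV.
have -> : x^-1 * z = x^-1 * y * (y^-1 * z) by rewrite -mulgA mulVKg.
exact: subgroupM.
Qed.

(** An index is given by a numbering of the cosets, seen as a function on
    the elements. *)
Lemma has_index_coding (G : groupType) (A : set G) (N : subgroup G) (n : nat) :
  (exists c : G -> nat,
    [/\ forall x y, A x -> A y -> c x = c y <-> (N : set G) (x^-1 * y),
        forall x, A x -> (c x < n)%N &
        forall i, (i < n)%N -> exists2 x, A x & c x = i]) <->
  has_index A N n.
Proof.
split=> [[c [cE cn cs]]|].
  apply/card_set_bijP.
  pose r (D : set G) : G := xget 1 [set x | A x /\ setM [set x] N = D].
  have rE x : A x -> let y := r (setM [set x] N) in
      A y /\ (N : set G) (y^-1 * x).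
    move=> Ax y; have [Ar rE] : A y /\ setM [set y] N = setM [set x] N.
      exact: (xgetPex 1 (P := [set y | A y /\ setM [set y] N = _]) (ex_intro _ x _)).
    by split=> //; apply/coset_eq.
  have crE x : A x -> c (r (setM [set x] N)) = c x.
    by move=> Ax; have [Ar Nr] := rE x Ax; apply/cE.
  exists (c \o r); split.
  - by move=> _ [x Ax <-]; rewrite /= crE //; exact: cn.
  - move=> _ _ /set_mem[x Ax <-] /set_mem[y Ay <-]; rewrite /= !crE // => cxy.
    by apply/coset_eq/cE.
  - move=> i /cs[x Ax <-]; exists (setM [set x] N); last exact: crE.
    by exists x.
move=> /card_set_bijP[f [fn fi fs]]; exists (fun x => f (setM [set x] N)); split.
- move=> x y Ax Ay; rewrite -coset_eq; split=> [|-> //].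
  by apply: fi; apply/mem_set; [exists x|exists y].
- by move=> x Ax; apply: fn; exists x.
- by move=> i /fs[_ [x Ax <-] <-]; exists x.
Qed.

(** * Finite quotients *)

(** [G] acts by right translation on the [n] numbered cosets of [N], and this
    action has kernel [N] since [N] is normal. *)
Lemma finite_quotient (G : groupType) (N : subgroup G) (n : nat) :
  normal_subgroup N -> has_index [set: G] N n ->
  exists (gT : finGroupType) (q : {ghom G -> gT}),
  [/\ forall y, exists x, q x = y, forall x, q x = 1 <-> (N : set G) x & #|gT| = n].
Proof.
move=> nN /has_index_coding[c [cE cn cs]].
have cE' x y : c x = c y <-> (N : set G) (x^-1 * y) by exact: cE.
have [r rE] : {r : 'I_n -> G & forall i, c (r i) = i}.
  apply: (choice (P := fun (i : 'I_n) x => c x = i)) => i.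
  by have [x _ xi] := cs i (ltn_ord i); exists x.
pose cI x : 'I_n := Ordinal (cn x I).
have cMr x y g : c x = c y -> c (x * g) = c (y * g).
  move=> /cE' Nxy; apply/cE'; apply: (nN g); exists (x^-1 * y) => //.
  by rewrite conjgE invgM !mulgA.
pose f g i := cI (r i * g).
have f_inj g : injective (f g).
  move=> i j /(congr1 val)/= /(cMr _ _ g^-1); rewrite !mulgK !rE.
  exact: val_inj.
pose phi g : {perm 'I_n} := perm (f_inj g).
have phiE g x : phi g (cI x) = cI (x * g).
  by rewrite permE; apply: val_inj; apply: cMr; rewrite rE.
have cIr i : cI (r i) = i by apply: val_inj; exact: rE.
have phiM : monoid.monoid_morphism phi.
  split=> [|g h]; apply/permP=> i; rewrite -[i]cIr phiE.
    by rewrite mulg1 perm1.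
  by rewrite permM !phiE mulgA.
have [gT [q [q_onto qE]]] := ghom_onto_im (ghom_of phiM).
have qN x y : q x = q y <-> (N : set G) (x^-1 * y).
  rewrite qE -cE' /=; split=> [E|cxy].
    have := congr1 (fun s : {perm 'I_n} => val (s (cI 1))) E.
    by rewrite !phiE /= !mul1g.
  apply/permP=> i; rewrite -[i]cIr !phiE; apply: val_inj => /=; apply/cE'.
  by rewrite invgM -mulgA mulKg; apply/cE'.
exists gT, q; split=> // [x|].
  rewrite -(@gmulf1 _ _ q).
  by split=> [/esym/qN|Nx]; [|apply/esym/qN]; rewrite invg1 mul1g.
have [k kK] := choice q_onto.
rewrite -[RHS]card_ord; apply: (@bij_eq_card _ _ (cI \o k)).
exists (q \o r) => [y|i] /=.
  by rewrite -[RHS]kK; apply/qN/cE'; rewrite rE.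
by rewrite -[RHS]cIr; apply: val_inj; apply/cE'/qN; rewrite kK.
Qed.

Section FiniteImageIndex.
Variables (G : groupType) (N : subgroup G) (gT : finGroupType).
Variable q : {ghom G -> gT}.
Hypothesis kerN : forall x, q x = 1 -> (N : set G) x.

Let QN := ghom_im_group (q \o @set_val G N).
Let QG := ghom_im_group q.

Lemma has_index_ghom : has_index [set: G] N #|QG : QN|.
Proof.
apply/has_index_coding.
have memQN x : q x \in QN <-> (N : set G) x.
  split=> [/ghom_imP[y _ /= qy]|Nx]; last first.
    pose y : N := SigSub (mem_set Nx).
    by apply/ghom_imP; exists y; rewrite //= set_valE.
  have Ny : (N : set G) (set_val y) by exact: set_valP.
  rewrite -(mulVKg (set_val y) x); apply: subgroupM => //; apply: kerN.
  by rewrite gmulfM gmulfV qy mulVg.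
pose L := enum (lcosets QN QG).
have LG x : q x *: QN \in L.
  by rewrite mem_enum; apply/lcosetsP; exists (q x) => //; exact: mem_ghom_im.
have sL : size L = #|QG : QN| by rewrite -cardE card_lcosets.
exists (fun x => index (q x *: QN) L); split.
- move=> x y _ _; rewrite -memQN; split=> [E|].
    have : q x *: QN = q y *: QN.
      by rewrite -(nth_index finset.set0 (LG x)) E nth_index.
    move/lcoset_eqP => qyx; move: qyx; rewrite mem_lcoset => qyx.
    by rewrite -groupV -gmulfV invgM invgK gmulfM gmulfV.
  rewrite gmulfM gmulfV -mem_lcoset => xy; congr index.
  by apply/esym/lcoset_eqP.
- by move=> x _; rewrite -sL index_mem.
move=> i; rewrite -sL => iL.
have : nth finset.set0 L i \in L by exact: mem_nth.
rewrite mem_enum => /lcosetsP[_ /ghom_imP[x _ <-] E].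
by exists x => //; rewrite -E index_uniq ?enum_uniq.
Qed.

Lemma has_index_p_power (p : nat) : p.-group [set: gT]%G ->
  exists n, has_index [set: G] N (p ^ n).
Proof.
move=> pG; have : p.-nat #|QG : QN|.
  exact: (pnat_dvd (dvdn_indexg _ _)) (pgroupS (finset.subsetT _) pG).
by move/p_natP=> [n En]; exists n; rewrite -En; exact: has_index_ghom.
Qed.
End FiniteImageIndex.

(** * Closed subgroups and finite discrete groups *)

Section ClosedSubgroups.
Variable P : topologicalGroupType.

Lemma open_subspaceE (V : set P) (U : set V) : open U ->
  exists2 O : set P, open O & forall v : V, O (set_val v) <-> U v.
Proof. by move=> [O oO <-]; exists O. Qed.

Lemma set_val_continuous (V : set P) : continuous (@set_val P V).
Proof. exact: initial_continuous. Qed.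

Lemma closed_subset_compact (V : set P) :
  compact [set: P] -> closed V -> compact [set: V].
Proof.
move=> cptP cV; have : compact V by exact: subclosed_compact cV cptP _.
move/compact_near_coveringP => covV; apply/compact_near_coveringP => J F Q FF nQ.
pose Q' i x := forall v : V, set_val v = x -> Q i v.
have : \near F, V `<=` Q' F.
  apply: covV => x Vx; pose v0 : V := SigSub (mem_set Vx).
  have [[A B] /= [nA FB] AB] := nQ v0 I.
  move: nA; rewrite nbhsE => -[U [oU Uv0] UA].
  have [O oO OU] := open_subspaceE oU.
  exists (O, B).
    split=> //; apply: open_nbhs_nbhs; split=> //.
    by have /OU := Uv0; rewrite set_valE.
  move=> [x' i] [/= Ox' Bi] v vx'; apply: (AB (v, i)); split=> //=.
  by apply/UA/OU; rewrite vx'.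
by apply: filterS => i VQ v _; apply: (VQ (set_val v)) => //; exact: set_valP.
Qed.

Lemma closed_subgroup_profinite (V : subgroup P) :
  profinite P -> closed (V : set P) -> profinite V.
Proof.
move=> proP cV; have [cptP hsdP _] := proP; split.
- exact: closed_subset_compact.
- rewrite open_hausdorff in hsdP; rewrite open_hausdorff => x y xy.
  have [|[O O'] /= [Ox Oy] [oO oO' OO']] := hsdP (set_val x) (set_val y).
    by apply: contra_neq xy => /set_val_inj.
  exists (@set_val P V @^-1` O, @set_val P V @^-1` O') => /=.
    by rewrite !inE /=; rewrite !inE in Ox Oy.
  split; [by exists O|by exists O'|].
  by rewrite -preimage_setI (eqP OO') preimage_set0.
- apply: zero_dimension_totally_disconnected => x y xy.
  have [|C [cC Cx Cy]] :=
    profinite_zero_dimensional proP (x := set_val x) (y := set_val y).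
    by apply: contra_neq xy => /set_val_inj.
  exists (@set_val P V @^-1` C); split=> //.
  by apply: preimage_clopen => //; exact: set_val_continuous.
Qed.

Lemma open_normal_quotient (p : nat) (N : subgroup P) : prime p -> pro_p p P ->
  open (N : set P) -> normal_subgroup N ->
  exists (gT : finGroupType) (q : {ghom P -> gT}),
  [/\ forall y, exists x, q x = y, forall x, q x = 1 <-> (N : set P) x,
      p.-group [set: gT]%G & exists n, forall x : gT, x ^+ (p ^ n) = 1].
Proof.
move=> p_pr [_ indexP] oN nN; have [n indN] := indexP _ oN nN.
have [gT [q [q_onto qN cT]]] := finite_quotient nN indN.
exists gT, q; split=> //; first by rewrite /pgroup cardsT cT pnatX pnat_id.
by exists n => x; rewrite -cT -cardsT; apply: expg_cardG; rewrite inE.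
Qed.

(** An open normal subgroup of [V] contains the trace of an open normal
    subgroup of [P], so its index is computed in a finite p-group. *)
Lemma closed_subgroup_pro_p (p : nat) (V : subgroup P) :
  prime p -> pro_p p P -> closed (V : set P) -> pro_p p V.
Proof.
move=> p_pr propP cV; have [proP _] := propP.
split=> [|N oN nN]; first exact: closed_subgroup_profinite.
have [O oO ON] := open_subspaceE oN.
have [|M [oM nM MO]] := profinite_open_normal (W := O) proP.
  apply: open_nbhs_nbhs; split=> //.
  rewrite -(@gmulf1 _ _ (@set_val P V)); apply/ON; exact: subgroup1.
have [gT [q [_ qM pG _]]] := open_normal_quotient p_pr propP oM nM.
apply: (has_index_p_power (q := q \o @set_val P V)) => // v /qM /MO.
by move/ON.
Qed.

End ClosedSubgroups.

(** An alias, so that the discrete topology is attached to it and not to the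
    finite group itself. *)
Definition finite_discrete (gT : finGroupType) : Type := gT.

HB.instance Definition _ (gT : finGroupType) := Group.copy (finite_discrete gT) gT.
HB.instance Definition _ (gT : finGroupType) :=
  Topological.copy (finite_discrete gT) (discrete_topology gT).
HB.instance Definition _ (gT : finGroupType) :=
  DiscreteTopology.copy (finite_discrete gT) (discrete_topology gT).

Section FiniteDiscrete.
Variable gT : finGroupType.
Local Notation D := (finite_discrete gT).

Lemma finite_discrete_open (A : set (D * D)) : open A.
Proof.
rewrite openE => -[x y] Axy; exists ([set x], [set y]).
  by split; exact: discrete_set1.
by move=> [x' y'] [/= -> ->].
Qed.

Lemma finite_discrete_mulg_continuous : continuous (fun x : D * D => x.1 * x.2).
Proof. by apply/continuousP => A _; exact: finite_discrete_open. Qed.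

Lemma finite_discrete_invg_continuous : continuous (fun x : D => x^-1).
Proof. by apply/continuousP => A _; exact: (@discrete_open D). Qed.

HB.instance Definition _ := PreTopologicalGroup_isTopologicalGroup.Build D
  finite_discrete_mulg_continuous finite_discrete_invg_continuous.

Lemma finite_discrete_pro_p (p : nat) :
  p.-group [set: gT]%G -> pro_p p (D : topologicalGroupType).
Proof.
move=> pG; split=> [|N _ _]; last first.
  have idM : monoid.monoid_morphism (fun x : D => x : gT) by [].
  apply: (has_index_p_power (q := ghom_of idM)) => // x /= ->.
  exact: subgroup1.
split; [exact/finite_compact/finite_finset|exact: discrete_hausdorff|].
exact/zero_dimension_totally_disconnected/discrete_zero_dimension.
Qed.
End FiniteDiscrete.

(** * The completion of an amalgam is a pushout *)

Lemma closed_equalizer (T U : topologicalType) (f g : T -> U) :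
  hausdorff_space U -> continuous f -> continuous g -> closed [set x | f x = g x].
Proof.
move=> hsdU cf cg x clx; apply: hsdU => A B nA nB.
have nAB : nbhs x (f @^-1` A `&` g @^-1` B).
  exact: (@filterI _ (nbhs x) _ _ _ (cf x _ nA) (cg x _ nB)).
have [y [/= fgy [Ay By]]] := clx _ nAB.
by exists (f y); split=> //; rewrite fgy.
Qed.

Lemma closure_sub (T : topologicalType) (A F : set T) :
  closed F -> A `<=` F -> closure A `<=` F.
Proof. by move=> cF AF; rewrite ((closure_id F).1 cF); exact: closureS. Qed.

Lemma dense_closed_subspace (P : topologicalGroupType) (A : set P)
    (C : set (closure A)) :
  closed C -> (forall v : closure A, A (set_val v) -> C v) -> forall v, C v.
Proof.
move=> cC AC v; have [O oO OC] := open_subspaceE (closed_openC cC).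
apply: contrapT => /OC Ov.
have [a [Aa Oa]] := @set_valP _ (closure A) v O (open_nbhs_nbhs (conj oO Ov)).
pose w : closure A := SigSub (mem_set (@subset_closure _ A _ Aa)).
have wa : set_val w = a by rewrite set_valE.
have : (~` C) w by apply/OC; rewrite wa.
by apply; apply: AC; rewrite wa.
Qed.

Lemma subfun_continuous (P : topologicalGroupType) (U V : set P) (UV : U `<=` V) :
  continuous (subfun UV : U -> V).
Proof.
apply: continuous_comp_initial; rewrite (_ : _ \o _ = @set_val P U).
  exact: set_val_continuous.
by apply/funext => x; rewrite /= !set_valE.
Qed.

Lemma preimage_subgroup1 (G H : groupType) (f : {ghom G -> H}) (W : subgroup H) :
  (f @^-1` W) 1.
Proof. by rewrite /= gmulf1; exact: subgroup1. Qed.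

Lemma preimage_subgroupF (G H : groupType) (f : {ghom G -> H}) (W : subgroup H) x y :
  (f @^-1` W) x -> (f @^-1` W) y -> (f @^-1` W) (x * y^-1).
Proof. by rewrite /= gmulfM gmulfV; exact: subgroupF. Qed.

Definition preimage_subgroup (G H : groupType) (f : {ghom G -> H})
    (W : subgroup H) : subgroup G :=
  Subgroup (preimage_subgroup1 f W) (@preimage_subgroupF _ _ f W).

Section Completion.
Variables (p : nat) (Gamma : groupType) (P : topologicalGroupType).
Variable rho : {ghom Gamma -> P}.
Hypothesis p_pr : prime p.
Hypothesis compl : is_pro_p_completion p rho.

(** The same argument as for amalgams, with the universal property of the
    completion. *)
Lemma completion_dense (W : subgroup P) :
  closed (W : set P) -> range rho `<=` W -> [set: P] `<=` W.
Proof.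
move=> cW rW; have [propP univ] := compl.
have [g gE] := ghom_corestrict rW.
have [phi [cphi phiE _]] := univ _ g (closed_subgroup_pro_p p_pr propP cW).
have [chi [_ _ uniq]] := univ _ rho propP.
have idE := uniq idfun (fun x => cvg_id) (fun _ => erefl).
have valE : @set_val P W \o phi =1 chi.
  apply: uniq => [x|h].
    by apply: continuous_comp; [exact: cphi|exact: set_val_continuous].
  exact: etrans (congr1 set_val (phiE h)) (gE h).
move=> x _; rewrite (idE x : x = _) -valE; exact: set_valP.
Qed.

Lemma completion_closure : closure (range rho) = [set: P].
Proof.
apply/seteqP; split=> // x _.
apply: (completion_dense (W := closure_subgroup (range_subgroup rho))) => //.
- exact: closed_closure.
- exact: subset_closure.
Qed.

Section Amalgam.
Variables (K H1 H2 : groupType).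
Variables (k1 : {ghom K -> H1}) (k2 : {ghom K -> H2}).
Variables (i1 : {ghom H1 -> Gamma}) (i2 : {ghom H2 -> Gamma}).
Hypothesis amalg : is_amalgamated_product k1 k2 i1 i2.

Let V1 := closure_subgroup (range_subgroup (rho \o i1)).
Let V2 := closure_subgroup (range_subgroup (rho \o i2)).
Let B := setI_subgroup V1 V2.
Let b1 : {ghom B -> V1} := subfun (@subIsetl P V1 V2).
Let b2 : {ghom B -> V2} := subfun (@subIsetr P V1 V2).
Let v1 : {ghom V1 -> P} := @set_val P V1.
Let v2 : {ghom V2 -> P} := @set_val P V2.

Lemma mem_V1 h : (V1 : set P) (rho (i1 h)).
Proof. by apply: subset_closure; exists h. Qed.

Lemma mem_V2 h : (V2 : set P) (rho (i2 h)).
Proof. by apply: subset_closure; exists h. Qed.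

Lemma range_subset_V (W : subgroup P) : 
  (V1 : set P) `<=` W -> (V2 : set P) `<=` W -> range rho `<=` W.
Proof.
move=> W1 W2 _ [g _ <-].
suff /(_ g I) : [set: Gamma] `<=` preimage_subgroup rho W by [].
apply: (amalgam_ind amalg) => _ [h _ <-] /=.
  by apply: W1; exact: mem_V1.
by apply: W2; exact: mem_V2.
Qed.

Lemma vertex_subgroups_generate (W : subgroup P) : closed (W : set P) ->
  (V1 : set P) `<=` W -> (V2 : set P) `<=` W -> [set: P] `<=` W.
Proof. by move=> cW W1 W2; apply: completion_dense => //; exact: range_subset_V. Qed.

Lemma completion_is_pushout : is_pro_p_pushout p b1 b2 v1 v2.
Proof.
have [propP univ] := compl; have [_ _ ik auniv] := amalg.
have cV1 : closed (V1 : set P) by exact: closed_closure.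
have cV2 : closed (V2 : set P) by exact: closed_closure.
split.
- by split=> //; apply: closed_subgroup_pro_p => //; exact: closedI.
- split; try exact: subfun_continuous; exact: set_val_continuous.
- by move=> x; rewrite /= /v1 /v2 !set_valE.
move=> R f1 f2 [profR pR] cf1 cf2 f12; have [cptR hsdR _] := profR.
have [h1 h1E] : exists h : {ghom H1 -> V1}, @set_val P V1 \o h =1 rho \o i1.
  by apply: ghom_corestrict; exact: subset_closure.
have [h2 h2E] : exists h : {ghom H2 -> V2}, @set_val P V2 \o h =1 rho \o i2.
  by apply: ghom_corestrict; exact: subset_closure.
have h12 : (f1 \o h1) \o k1 =1 (f2 \o h2) \o k2.
  move=> k; have ikk : i1 (k1 k) = i2 (k2 k) by exact: ik.
  have Bk : (B : set P) (rho (i1 (k1 k))).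
    by split; [exact: mem_V1|rewrite ikk; exact: mem_V2].
  pose b : B := SigSub (mem_set Bk).
  have e1 : h1 (k1 k) = b1 b.
    apply: set_val_inj; rewrite [LHS]h1E; by rewrite /b1 !set_valE.
  have e2 : h2 (k2 k) = b2 b.
    apply: set_val_inj; rewrite [LHS]h2E /=; by rewrite /b2 !set_valE /= ikk.
  by rewrite /= e1 e2; exact: f12.
have [chi [chi1 chi2 chiU]] := auniv _ (f1 \o h1) (f2 \o h2) h12.
have [phi [cphi phiE phiU]] := univ _ chi (conj profR pR).
exists phi; split=> //.
- have cl : closed [set v : V1 | (phi \o v1) v = f1 v].
    apply: closed_equalizer => // x.
    by apply: continuous_comp; [exact: set_val_continuous|exact: cphi].
  apply: (dense_closed_subspace cl) => v [h _ /= hv].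
  have -> : v = h1 h by apply: set_val_inj; rewrite -hv; exact/esym/h1E.
  by rewrite /v1 (h1E h : set_val (h1 h) = _) /=; exact: etrans (phiE _) (chi1 h).
- have cl : closed [set v : V2 | (phi \o v2) v = f2 v].
    apply: closed_equalizer => // x.
    by apply: continuous_comp; [exact: set_val_continuous|exact: cphi].
  apply: (dense_closed_subspace cl) => v [h _ /= hv].
  have -> : v = h2 h by apply: set_val_inj; rewrite -hv; exact/esym/h2E.
  by rewrite /v2 (h2E h : set_val (h2 h) = _) /=; exact: etrans (phiE _) (chi2 h).
move=> psi cpsi psi1 psi2; apply: phiU => //; apply: (chiU (psi \o rho)) => h /=.
  by rewrite -[rho _]h1E; exact: psi1.
by rewrite -[rho _]h2E; exact: psi2.
Qed.

Lemma pushout_unique (Q : topologicalGroupType)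
     (j1 : {ghom V1 -> Q}) (j2 : {ghom V2 -> Q}) :
   is_pro_p_pushout p b1 b2 j1 j2 ->
   [/\ exists theta : {ghom Q -> P},
           [/\ topological_isomorphism theta,
               theta \o j1 =1 v1 & theta \o j2 =1 v2],
         injective j1 & injective j2].
Proof.
have [[_ _ _ propP] [_ _ cv1 cv2] vb univP] := completion_is_pushout.
move=> [[_ _ _ propQ] [_ _ cj1 cj2] jb univQ].
have [theta [ct t1 t2 _]] := univQ _ v1 v2 propP cv1 cv2 vb.
have [phi [cp p1 p2 _]] := univP _ j1 j2 propQ cj1 cj2 jb.
have [e [_ _ _ eU]] := univP _ v1 v2 propP cv1 cv2 vb.
have [f [_ _ _ fU]] := univQ _ j1 j2 propQ cj1 cj2 jb.
have phiK : cancel phi theta.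
  move=> x; apply: etrans (esym (eU idfun _ _ _ x)) => //.
  - apply: (eU (theta \o phi)) => [y|v|v].
    + by apply: continuous_comp; [exact: cp|exact: ct].
    + exact: etrans (congr1 theta (p1 v)) (t1 v).
    + exact: etrans (congr1 theta (p2 v)) (t2 v).
  - by move=> y; exact: cvg_id.
have thetaK : cancel theta phi.
  move=> x; apply: etrans (esym (fU idfun _ _ _ x)) => //.
  - apply: (fU (phi \o theta)) => [y|v|v].
    + by apply: continuous_comp; [exact: ct|exact: cp].
    + exact: etrans (congr1 phi (t1 v)) (p1 v).
    + exact: etrans (congr1 phi (t2 v)) (p2 v).
  - by move=> y; exact: cvg_id.
split.
- by exists theta; split=> //; split=> //; exists phi.
- move=> x y /(congr1 theta) xy; apply: set_val_inj.
  by rewrite -[set_val x]t1 -[set_val y]t1.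
- move=> x y /(congr1 theta) xy; apply: set_val_inj.
  by rewrite -[set_val x]t2 -[set_val y]t2.
Qed.

End Amalgam.
End Completion.

(** * Bounded generation *)

Local Notation setprod C s := (\big[@setM _/[set 1]]_(g <- s) C g).

Section BoundedGeneration.
Variable P : topologicalGroupType.
Hypothesis cptP : compact [set: P].
Hypothesis hsdP : hausdorff_space P.

Lemma setM_closed (A B : set P) : closed A -> closed B -> closed (setM A B).
Proof.
move=> cA cB.
have cptA : compact A by exact: subclosed_compact cA cptP _.
have cptB : compact B by exact: subclosed_compact cB cptP _.
have -> : setM A B = (fun z : P * P => z.1 * z.2) @` (A `*` B).
  apply/seteqP; split=> [_ [a Aa [b Bb <-]]|_ [[a b] [/= Aa Bb] <-]].
    by exists (a, b).
  by exists a => //; exists b.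
apply: compact_closed => //; apply: continuous_compact; last exact: compact_setX.
by apply: continuous_subspaceT => x; exact: mulg_continuous.
Qed.

Lemma closure_cyclic_prod_closed (s : seq P) :
  closed (setprod (fun g => closure (cyclic_set g)) s).
Proof.
elim: s => [|g s IH].
  by rewrite big_nil; apply: compact_closed => //; exact: compact_set1.
by rewrite big_cons; apply: setM_closed => //; exact: closed_closure.
Qed.

(** The product of the closures is compact, hence closed, and contains the
    image of [H]. *)
Lemma boundedly_generated_closure (H : groupType) (f : {ghom H -> P}) :
  boundedly_generated H ->
  exists s, closure (range f) `<=` setprod (fun g => closure (cyclic_set g)) s.
Proof.
move=> [s sH]; exists (map f s); apply: closure_sub.
  exact: closure_cyclic_prod_closed.
move=> _ [h _ <-]; have : setprod (@cyclic_set H) s h by rewrite sH.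
elim: s h {sH} => [|g s IH] h /=.
  by rewrite !big_nil => ->; rewrite gmulf1.
rewrite !big_cons => -[a [n an] [b sb <-]].
exists (f a); last by exists (f b); [exact: IH|rewrite gmulfM].
apply: subset_closure; exists n.
by case: an => ->; [left|right]; rewrite ?gmulfXVn ?gmulfXn.
Qed.

(** A continuous morphism to a finite discrete group maps a procyclic
    subgroup into a cyclic one, of order at most [e]. *)
Lemma boundedly_generated_quotient (s : seq P) (gT : finGroupType) (e : nat)
    (phi : {ghom P -> finite_discrete gT}) :
  setprod (fun g => closure (cyclic_set g)) s = [set: P] ->
  continuous phi -> (forall y, exists x, phi x = y) -> (0 < e)%N ->
  (forall x : gT, x ^+ e = 1) -> (#|gT| <= e ^ size s)%N.
Proof.
move=> sP cphi phi_onto e_gt0 expT.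
have phi_cyclic g x : closure (cyclic_set g) x ->
    phi x \in (<[phi g : gT]> : {set gT}).
  pose F : set (finite_discrete gT) := [set y | y \in (<[phi g : gT]> : {set gT})].
  apply: (closure_sub (F := phi @^-1` F)).
    move/continuous_closedP: cphi; apply.
    exact: (@discrete_closed (finite_discrete gT)).
  move=> _ [n [->|->]]; rewrite /F /= ?gmulfV ?gmulfXn.
    exact: mem_cycle.
  by apply: groupVr; exact: mem_cycle.
have [F cF FE] : exists2 F : {set gT}, (#|F| <= e ^ size s)%N &
    forall x, setprod (fun g => closure (cyclic_set g)) s x -> (phi x : gT) \in F.
  elim: s {sP} => [|g s [F cF FE]].
    exists (finset.set1 1); first by rewrite cards1.
    by move=> x; rewrite big_nil => ->; rewrite gmulf1 inE.
  pose f (z : gT * gT) := z.1 * z.2.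
  exists (f @: finset.setX <[phi g : gT]>%SET F).
    apply: leq_trans (leq_imset_card _ _) _; rewrite cardsX expnS leq_mul //.
    by apply: dvdn_leq => //; rewrite order_dvdn expT.
  move=> x; rewrite big_cons => -[a ga [b sb <-]].
  rewrite gmulfM; apply/imsetP; exists (phi a : gT, phi b : gT) => //.
  by rewrite finset.in_setX phi_cyclic // FE.
apply: leq_trans cF; rewrite -cardsT; apply: subset_leq_card.
apply/fintype.subsetP => y _; have [x <-] := phi_onto y.
by apply: FE; rewrite sP.
Qed.

End BoundedGeneration.

Lemma amalgam_quotient_bound (p : nat) (Gamma : groupType)
    (P : topologicalGroupType) (rho : {ghom Gamma -> P}) (s : seq P)
    (gT : finGroupType) (pi : {ghom Gamma -> gT}) (n : nat) :
  prime p -> is_pro_p_completion p rho ->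
  setprod (fun g => closure (cyclic_set g)) s = [set: P] ->
  (forall y, exists g, pi g = y) -> (forall x : gT, x ^+ (p ^ n) = 1) ->
  (#|gT| <= (p ^ n) ^ size s)%N.
Proof.
move=> p_pr [[[cptP hsdP _] _] univ] sP pi_onto expT.
have pG : p.-group [set: gT]%G.
  apply/pgroupP => q q_pr /(Cauchy q_pr)[x _ ox].
  have : q %| p ^ n by rewrite -ox order_dvdn expT.
  by rewrite Euclid_dvdX // dvdn_prime2 // => /andP[].
have piM : monoid.monoid_morphism (pi : Gamma -> finite_discrete gT).
  by split=> [|x y]; rewrite ?gmulf1 ?gmulfM.
have [phi [cphi phiE _]] := univ _ (ghom_of piM) (finite_discrete_pro_p pG).
apply: (boundedly_generated_quotient sP cphi) => //.
  by move=> y; have [g <-] := pi_onto y; exists (rho g); exact: phiE.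
by rewrite expn_gt0 prime_gt0.
Qed.

Section CyclicSet.
Variables (G : groupType) (z : G).

Lemma cyclic_set1 : cyclic_set z 1.
Proof. by exists 0%N; left. Qed.

Lemma cyclic_set_id : cyclic_set z z.
Proof. by exists 1%N; left. Qed.

Lemma cyclic_setMz c : cyclic_set z c -> cyclic_set z (c * z).
Proof.
move=> [n [->|->]]; first by exists n.+1; left; rewrite expgSr.
case: n => [|n]; first by exists 1%N; left; rewrite expg0 invg1 mul1g expg1.
by exists n; right; rewrite expgS invgM mulgVK.
Qed.

Lemma cyclic_setMVz c : cyclic_set z c -> cyclic_set z (c * z^-1).
Proof.
move=> [n [->|->]]; last by exists n.+1; right; rewrite expgS invgM.
case: n => [|n]; first by exists 1%N; right; rewrite expg0 mul1g expg1.
by exists n; left; rewrite expgSr mulgK.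
Qed.

Lemma cyclic_setF c d : cyclic_set z c -> cyclic_set z d -> cyclic_set z (c * d^-1).
Proof.
move=> zc [n]; case=> ->; elim: n c zc => [|n IH] c zc.
- by rewrite expg0 invg1 mulg1.
- by rewrite expgSr invgM mulgA; apply/IH/cyclic_setMVz.
- by rewrite expg0 !invg1 mulg1.
- by rewrite invgK expgS mulgA -[z ^+ n]invgK; apply/IH/cyclic_setMz.
Qed.

Definition cyclic_subgroup := Subgroup cyclic_set1 cyclic_setF.

Lemma cyclic_set_sub (W : subgroup G) : (W : set G) z -> cyclic_set z `<=` W.
Proof.
move=> Wz t [n cn]; have Wn : (W : set G) (z ^+ n).
  elim: n {cn} => [|n IH]; first exact: subgroup1.
  by rewrite expgS; exact: subgroupM.
by case: cn => ->; [|apply: subgroupV].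
Qed.

End CyclicSet.

Definition normalizes (G : groupType) (B : subgroup G) (g : G) :=
  forall b, (B : set G) b <-> (B : set G) (b ^ g).

Section Normalized.
Variables (G : groupType) (B : subgroup G).

Lemma normalizer1 : normalizes B 1.
Proof. by move=> b; rewrite conjg1. Qed.

Lemma normalizerF x y : normalizes B x -> normalizes B y -> normalizes B (x * y^-1).
Proof.
move=> Nx Ny b; have := Ny ((b ^ x) ^ y^-1); rewrite conjgKV -conjgM => E.
exact: iff_trans (Nx b) (iff_sym E).
Qed.

Definition normalizer := Subgroup normalizer1 normalizerF.

Variable C : subgroup G.
Hypothesis CB : (C : set G) `<=` normalizer.

Lemma setM_subgroup1 : setM C B 1.
Proof.
by exists 1; [exact: subgroup1|exists 1; [exact: subgroup1|rewrite mulg1]].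
Qed.

Lemma setM_subgroupF x y : setM C B x -> setM C B y -> setM C B (x * y^-1).
Proof.
move=> [c Cc [b Bb <-]] [c' Cc' [b' Bb' <-]].
exists (c * c'^-1); first exact: subgroupF.
exists ((b * b'^-1) ^ c'^-1).
  have NV : (normalizer : set G) c'^-1 by apply: subgroupV; exact: CB.
  by apply: (iffLR (NV _)); exact: subgroupF.
by rewrite conjgE invgK invgM !mulgA mulgVK.
Qed.

Definition setM_subgroup := Subgroup setM_subgroup1 setM_subgroupF.
End Normalized.

Lemma proper_witness (T : Type) (B A : set T) : B `<=` A -> B <> A ->
  exists x, A x /\ ~ B x.
Proof.
move=> BA nBA; apply: contrapT => nx; apply: nBA; apply/seteqP; split=> // x Ax.
by apply: contrapT => nBx; apply: nx; exists x.
Qed.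

(** The index of [B] in [A] is 1 or 2, said without representatives so that any
    two elements of [A] outside [B] can be compared. *)
Definition index_le2 (G : groupType) (A B : subgroup G) : Prop :=
  forall x y, (A : set G) x -> (A : set G) y -> ~ (B : set G) x -> ~ (B : set G) y ->
    (B : set G) (x^-1 * y).

Lemma has_index2P (G : groupType) (A B : subgroup G) : (B : set G) `<=` A ->
  has_index A B 2 <-> index_le2 A B /\ (B : set G) <> A.
Proof.
move=> BA; have A1 : (A : set G) 1 by exact: subgroup1.
rewrite -has_index_coding; split=> [[c [cE cn cs]]|[le2 nBA]].
  have nB x : (A : set G) x -> ~ (B : set G) x -> c x <> c 1.
    by move=> Ax nBx; apply/cE => // /subgroupV; rewrite invgM invgK invg1 mul1g.
  split=> [x y Ax Ay nBx nBy|BAE].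
    apply/cE => //; move: (nB x Ax nBx) (nB y Ay nBy) (cn x Ax) (cn y Ay) (cn 1 A1).
    by move: (c x) (c y) (c 1) => [|[|?]] [|[|?]] [|[|?]].
  have [x Ax x0] := cs 0%N isT; have [y Ay y1] := cs 1%N isT.
  have : c x = c y.
    by apply/cE => //; rewrite BAE; apply: subgroupM => //; exact: subgroupV.
  by rewrite x0 y1.
have [a [Aa nBa]] := proper_witness BA nBA.
exists (fun x => if `[< (B : set G) x >] then 0%N else 1%N); split.
- move=> x y Ax Ay; case: asboolP => Bx; case: asboolP => By; split=> //.
  + by move=> _; apply: subgroupM => //; exact: subgroupV.
  + by move=> Bxy; exfalso; apply: By; rewrite -(mulVKg x y); exact: subgroupM.
  + move=> Bxy; exfalso; apply: Bx; rewrite -(invgK x); apply: subgroupV.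
    by rewrite -(mulgK y x^-1); exact: subgroupF.
  + by move=> _; exact: le2.
- by move=> x _; case: ifP.
- case=> [|[|//]] _; first by exists 1 => //; rewrite asboolT //; exact: subgroup1.
  by exists a => //; rewrite asboolF.
Qed.

Section IndexTwo.
Variables (G : groupType) (A B : subgroup G).
Hypothesis BA : (B : set G) `<=` A.
Hypothesis le2 : index_le2 A B.

Lemma index_le2_mul x y : (A : set G) x -> (A : set G) y ->
  ~ (B : set G) x -> ~ (B : set G) y -> (B : set G) (x * y).
Proof.
move=> Ax Ay nBx nBy; rewrite -(invgK x); apply: le2 => //; first exact: subgroupV.
by move=> /subgroupV; rewrite invgK.
Qed.

Lemma index_le2_normal : (A : set G) `<=` normalizer B.
Proof.
have J a b : (A : set G) a -> (B : set G) b -> (B : set G) (b ^ a).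
  move=> Aa Bb; have [Ba|nBa] := pselect ((B : set G) a).
    by rewrite conjgE; apply: subgroupM; [exact: subgroupV|exact: subgroupM].
  rewrite conjgE; apply: le2 => //; first by apply: subgroupM => //; exact: BA.
  move=> Bba; apply: nBa; rewrite -(mulKg b a); apply: subgroupM => //.
  exact: subgroupV.
move=> a Aa b; split; first exact: J.
by move=> Bba; rewrite -(conjgK a b); apply: J => //; exact: subgroupV.
Qed.
End IndexTwo.

Section Dihedral.
Variables (G : groupType) (V1 V2 B : subgroup G).
Hypotheses (BV1 : (B : set G) `<=` V1) (BV2 : (B : set G) `<=` V2).
Hypotheses (le1 : index_le2 V1 B) (le2 : index_le2 V2 B).
Variables x y : G.
Hypotheses (V1x : (V1 : set G) x) (nBx : ~ (B : set G) x).
Hypotheses (V2y : (V2 : set G) y) (nBy : ~ (B : set G) y).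

Let z := x * y.
Let Nz : cyclic_set z `<=` normalizer B.
Proof.
apply: (@cyclic_set_sub _ _ (normalizer B)); apply: subgroupM.
  exact: (index_le2_normal BV1 le1).
exact: (index_le2_normal BV2 le2).
Qed.
Let M := setM_subgroup (C := cyclic_subgroup z) Nz.

Let BM : (B : set G) `<=` M.
Proof.
move=> b Bb; exists 1; first exact: cyclic_set1.
by exists b => //; rewrite mul1g.
Qed.

Let zM : (M : set G) z.
Proof.
exists z; first exact: cyclic_set_id.
by exists 1; [exact: subgroup1|rewrite mulg1].
Qed.

Let M_conj m : (M : set G) m -> (M : set G) (x * m * x^-1).
Proof.
have NxV : (normalizer B : set G) x^-1.
  by apply: subgroupV; exact: (index_le2_normal BV1 le1).
have Mz : (M : set G) (z ^ x^-1).
  (* The squares of [x] and [y] lie in [B]. *)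
  have -> : z ^ x^-1 = (x * x) * (y * y) * z^-1.
    by rewrite conjgE invgK invgM !mulgA mulgK.
  apply: subgroupF => //; apply: subgroupM; apply: BM.
    exact: (index_le2_mul le1).
  exact: (index_le2_mul le2).
move=> [c Zc [b Bb <-]].
have -> : x * (c * b) * x^-1 = c ^ x^-1 * b ^ x^-1.
  by rewrite -conjMg conjgE invgK !mulgA.
apply: subgroupM; last by apply: BM; apply: (iffLR (NxV _)).
case: Zc => n [->|->]; rewrite ?conjVg conjXg.
  by apply: (cyclic_set_sub (W := M) Mz); exists n; left.
by apply: (cyclic_set_sub (W := M) Mz); exists n; right.
Qed.

Let T := setM M V1.

Let T1 v t : (V1 : set G) v -> T t -> T (v * t).
Proof.
move=> V1v [m Mm [u V1u <-]]; rewrite /T.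
have [Bv|nBv] := pselect ((B : set G) v).
  by exists (v * m); [apply: subgroupM => //; exact: BM|exists u; rewrite // mulgA].
have Bvx : (B : set G) (v * x^-1).
  apply: (index_le2_mul le1) => //; first exact: subgroupV.
  by move/subgroupV; rewrite invgK.
exists (v * x^-1 * (x * m * x^-1)).
  by apply: subgroupM; [exact: BM|exact: M_conj].
exists (x * u); first exact: subgroupM.
by rewrite !mulgA !mulgVK.
Qed.

Let TM m t : (M : set G) m -> T t -> T (m * t).
Proof.
move=> Mm [m' Mm' [u V1u <-]]; exists (m * m'); first exact: subgroupM.
by exists u; rewrite // mulgA.
Qed.

Let T2 v t : (V2 : set G) v -> T t -> T (v * t).
Proof.
move=> V2v Tt; have [Bv|nBv] := pselect ((B : set G) v).
  by apply: T1 => //; exact: BV1.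
have Bvy : (B : set G) (v * y^-1).
  apply: (index_le2_mul le2) => //; first exact: subgroupV.
  by move/subgroupV; rewrite invgK.
have -> : v * t = v * y^-1 * (x^-1 * (z * t)).
  by rewrite /z !mulgA mulgVK mulgVK.
apply: TM; first exact: BM.
by apply: T1; [exact: subgroupV|exact: TM].
Qed.

(** Modulo [B], the elements [x] and [y] are involutions, and [x] inverts
    [z = x * y].  So [M], the product of the powers of [z] and of [B], is a
    subgroup stable under conjugation by [x], and [M V1] is stable under left
    multiplication by [V1] and by [V2]. *)
Lemma dihedral_generation : exists W : subgroup G,
  [/\ (V1 : set G) `<=` W, (V2 : set G) `<=` W &
      (W : set G) `<=` setM (cyclic_set z) V1].
Proof.
pose Q : set G := [set g | forall t, T t <-> T (g * t)].
have Q1 : Q 1 by move=> t; rewrite mul1g.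
have QF a b : Q a -> Q b -> Q (a * b^-1).
  by move=> Qa Qb t; rewrite -mulgA -Qa (Qb (b^-1 * t)) mulVKg.
exists (Subgroup Q1 QF); split=> [v V1v t|v V2v t|g Qg].
- split; first exact: T1.
  by move/(T1 (subgroupV V1v)); rewrite mulKg.
- split; first exact: T2.
  by move/(T2 (subgroupV V2v)); rewrite mulKg.
have TT : T 1.
  exists 1; first exact: subgroup1.
  by exists 1; [exact: subgroup1|rewrite mulg1].
have [_ [c Zc [b Bb <-]] [v V1v]] := (Qg 1).1 TT; rewrite mulg1 => <-.
exists c => //; exists (b * v); first by apply: subgroupM => //; exact: BV1.
by rewrite mulgA.
Qed.
End Dihedral.

(** * The characterization of bounded generation *)

Section Characterization.
Variables (p : nat) (K H1 H2 Gamma : groupType).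
Variables (k1 : {ghom K -> H1}) (k2 : {ghom K -> H2}).
Variables (i1 : {ghom H1 -> Gamma}) (i2 : {ghom H2 -> Gamma}).
Variables (P : topologicalGroupType) (rho : {ghom Gamma -> P}).
Hypothesis p_pr : prime p.
Hypothesis amalg : is_amalgamated_product k1 k2 i1 i2.
Hypothesis compl : is_pro_p_completion p rho.

Let V1 := closure_subgroup (range_subgroup (rho \o i1)).
Let V2 := closure_subgroup (range_subgroup (rho \o i2)).
Let B := setI_subgroup V1 V2.

Let cV1 : closed (V1 : set P). Proof. exact: closed_closure. Qed.
Let cV2 : closed (V2 : set P). Proof. exact: closed_closure. Qed.
Let propP : pro_p p P. Proof. by case: compl. Qed.
Let cptP : compact [set: P]. Proof. by case: propP => [[]]. Qed.
Let hsdP : hausdorff_space P. Proof. by case: propP => [[]]. Qed.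

Lemma degenerate_boundedly_generated :
  boundedly_generated H1 -> boundedly_generated H2 ->
  (B = V1 :> set P \/ B = V2 :> set P) \/ (has_index V1 B 2 /\ has_index V2 B 2) ->
  topologically_boundedly_generated P.
Proof.
move=> bg1 bg2.
have [s1 V1s] := boundedly_generated_closure cptP hsdP (rho \o i1) bg1.
have [s2 V2s] := boundedly_generated_closure cptP hsdP (rho \o i2) bg2.
have sub := vertex_subgroups_generate p_pr compl amalg.
case=> [[BV|BV]|[ind1 ind2]].
- exists s2; apply/seteqP; split=> // x _; apply: V2s.
  by apply: (sub V2) => // v; rewrite -/V1 -BV => -[].
- exists s1; apply/seteqP; split=> // x _; apply: V1s.
  by apply: (sub V1) => // v; rewrite -/V2 -BV => -[].
have BV1 : (B : set P) `<=` V1 by move=> ? [].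
have BV2 : (B : set P) `<=` V2 by move=> ? [].
have [le1 nBV1] := (has_index2P BV1).1 ind1.
have [le2 nBV2] := (has_index2P BV2).1 ind2.
have [x [V1x nBx]] := proper_witness BV1 nBV1.
have [y [V2y nBy]] := proper_witness BV2 nBV2.
have [W [W1 W2 WT]] := dihedral_generation BV1 BV2 le1 le2 V1x nBx V2y nBy.
exists (x * y :: s1); apply/seteqP; split=> // t _; rewrite big_cons.
have rW : range rho `<=` W by exact: (range_subset_V amalg W1 W2).
have : closure (range rho) t by rewrite (completion_closure p_pr compl).
apply: closure_sub.
  apply: setM_closed => //; first exact: closed_closure.
  exact: closure_cyclic_prod_closed.
move=> u /rW /WT [c Zc [v V1v <-]].
by exists c; [exact: subset_closure|exists v => //; exact: V1s].
Qed.

(** [B] is closed, so finitely many elements outside it can be separated from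
    it by one open normal subgroup; density in [P] becomes equality in the
    quotient. *)
Lemma separating_quotient (l : seq P) : (forall z, z \in l -> ~ (B : set P) z) ->
  exists (gT : finGroupType) (q : {ghom P -> gT}),
  [/\ forall y, exists x, q x = y, p.-group [set: gT]%G,
      exists n, forall x : gT, x ^+ (p ^ n) = 1,
      forall (A : set P) x, closure A x -> exists2 a, A a & q a = q x &
      forall z b, z \in l -> (B : set P) b -> q z <> q b].
Proof.
move=> lB; pose W : set P := [set n | forall z, z \in l -> ~ (B : set P) (z * n)].
have cB : closed (B : set P) by exact: closedI.
have nW : nbhs 1 W.
  rewrite /W; elim: l lB {W} => [|z l IH] lB.
    by apply: filterS (filterT : nbhs (1 : P) setT) => n _ z; rewrite in_nil.
  have {}IH : nbhs (1 : P) [set n | forall y, y \in l -> ~ (B : set P) (y * n)].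
    by apply: IH => y yl; apply: lB; rewrite inE yl orbT.
  have nz : nbhs (1 : P) [set n | ~ (B : set P) (z * n)].
    have c1 : {for 1, continuous (fun n : P => z * n)}.
      by apply: mulg_continuous2; [exact: cvg_cst|exact: cvg_id].
    apply: (c1 (~` B)); apply: open_nbhs_nbhs; split; first exact: closed_openC.
    by rewrite mulg1; apply: lB; rewrite inE eqxx.
  apply: filterS (filterI nz IH) => n [nBz nBl] y.
  by rewrite inE => /orP[/eqP->|/nBl].
have [N [oN nN NW]] := profinite_open_normal propP.1 nW.
have [gT [q [q_onto qN pG expT]]] := open_normal_quotient p_pr propP oN nN.
exists gT, q; split=> // [A x clx|z b zl Bb qzb].
  have cx : {for x, continuous (fun n : P => x^-1 * n)}.
    by apply: mulg_continuous2; [exact: cvg_cst|exact: cvg_id].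
  have nx : nbhs x [set y | (N : set P) (x^-1 * y)].
    apply: (cx (N : set P)); apply: open_nbhs_nbhs; split=> //.
    by rewrite mulVg; exact: subgroup1.
  have [a [Aa /qN]] := clx _ nx; rewrite gmulfM gmulfV => xa.
  by exists a => //; rewrite -(mulVKg (q x) (q a)) xa mulg1.
have : W (z^-1 * b) by apply/NW/qN; rewrite gmulfM gmulfV qzb mulVg.
by move/(_ z zl); rewrite mulVKg.
Qed.

Section QuotientIndices.
Variables (gT : finGroupType) (q : {ghom P -> gT}).
Hypothesis q_onto : forall y, exists x, q x = y.
Hypothesis q_dense : forall (A : set P) x, closure A x -> exists2 a, A a & q a = q x.

Let pi : {ghom Gamma -> gT} := q \o rho.
Let A1 := ghom_im_group (pi \o i1).
Let A2 := ghom_im_group (pi \o i2).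
Let C := ghom_im_group (pi \o (i1 \o k1)).
Let QB := ghom_im_group (q \o @set_val P B).

Lemma pi_onto y : exists g, pi g = y.
Proof.
have [x <-] := q_onto y.
have [|_ [g _ <-] gx] := q_dense (A := range rho) (x := x).
  by rewrite (completion_closure p_pr compl).
by exists g.
Qed.

Lemma q_V1 x : (V1 : set P) x -> q x \in A1.
Proof. by move=> /q_dense[_ [h _ <-] <-]; exact: (mem_ghom_im (pi \o i1)). Qed.

Lemma q_V2 x : (V2 : set P) x -> q x \in A2.
Proof. by move=> /q_dense[_ [h _ <-] <-]; exact: (mem_ghom_im (pi \o i2)). Qed.

Lemma QB1 : QB \subset A1.
Proof.
apply/fintype.subsetP => _ /ghom_imP[b _ <-] /=; apply: q_V1.
by have [] := @set_valP _ B b.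
Qed.

Lemma QB2 : QB \subset A2.
Proof.
apply/fintype.subsetP => _ /ghom_imP[b _ <-] /=; apply: q_V2.
by have [] := @set_valP _ B b.
Qed.

Lemma C_QB : C \subset QB.
Proof.
apply/fintype.subsetP => _ /ghom_imP[k _ <-] /=.
have Bk : (B : set P) (rho (i1 (k1 k))).
  split; first exact: mem_V1.
  case: amalg => _ _ ik _; have -> : i1 (k1 k) = i2 (k2 k) by exact: ik.
  exact: mem_V2.
pose b : B := SigSub (mem_set Bk).
by apply/ghom_imP; exists b; rewrite //= set_valE.
Qed.

(** The image of [K] lies in the image [QB] of [B], so it suffices to compare
    with |G : QB|, and 1 / m + 1 / n < 1 for integers [m, n >= 2] that are not
    both 2. *)
Lemma index_im_lt : (1 < #|A1 : QB|)%N -> (1 < #|A2 : QB|)%N ->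
  (2 < #|A1 : QB|)%N \/ (2 < #|A2 : QB|)%N ->
  (#|[set: gT]%G : A1| + #|[set: gT]%G : A2| < #|[set: gT]%G : C|)%N.
Proof.
have E1 : (#|[set: gT]%G : A1| * #|A1 : QB| = #|[set: gT]%G : QB|)%N.
  by apply: Lagrange_index; [exact: finset.subsetT|exact: QB1].
have E2 : (#|[set: gT]%G : A2| * #|A2 : QB| = #|[set: gT]%G : QB|)%N.
  by apply: Lagrange_index; [exact: finset.subsetT|exact: QB2].
have : (#|[set: gT]%G : QB| <= #|[set: gT]%G : C|)%N.
  by apply: dvdn_leq; [exact: indexg_gt0|apply: indexgS; exact: C_QB].
have : (0 < #|[set: gT]%G : QB|)%N by exact: indexg_gt0.
move: E1 E2; move: #|_ : QB| #|_ : QB| #|_ : QB| => a b c.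
move: #|_ : A1| #|_ : A2| #|_ : C| => x y z; nia.
Qed.

End QuotientIndices.

(** Outside the listed cases, elements of [V1] and [V2] outside [B], and three
    cosets of [B] in one of them when some index exceeds 2, stay distinct in
    some finite p-quotient.  When both indices are 2, [p] is odd, and the
    indices in the quotient are at least 3 because they are powers of [p]. *)
Lemma boundedly_generated_degenerate :
  topologically_boundedly_generated P ->
  (B = V1 :> set P \/ B = V2 :> set P) \/
    [/\ p = 2, has_index V1 B 2 & has_index V2 B 2].
Proof.
move=> [s sP]; apply: contrapT => /not_orP[/not_orP[nBV1 nBV2] n2].
have BV1 : (B : set P) `<=` V1 by move=> ? [].
have BV2 : (B : set P) `<=` V2 by move=> ? [].
have [x1 [V1x nBx1]] := proper_witness BV1 nBV1.
have [x2 [V2x nBx2]] := proper_witness BV2 nBV2.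
have nle (V : subgroup P) : ~ index_le2 V B -> exists y z,
    [/\ (V : set P) y, (V : set P) z, ~ (B : set P) y, ~ (B : set P) z &
    ~ (B : set P) (y^-1 * z)].
  move=> nV; apply: contrapT => nyz; apply: nV => y z Vy Vz nBy nBz.
  by apply: contrapT => nByz; apply: nyz; exists y, z.
(* [1], [y] and [z] represent distinct cosets of [B] once [l] misses [B]. *)
pose three_cosets (V : subgroup P) (l : seq P) := exists y z,
  [/\ (V : set P) y, (V : set P) z, y \in l, z \in l & y^-1 * z \in l].
have [l [lB l1 l2 lbig]] : exists l : seq P,
  [/\ forall z, z \in l -> ~ (B : set P) z, x1 \in l, x2 \in l &
    [\/ p != 2, three_cosets V1 l | three_cosets V2 l]].
  have big (V : subgroup P) : ~ index_le2 V B -> exists l : seq P,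
      [/\ forall z, z \in l -> ~ (B : set P) z, x1 \in l, x2 \in l &
        three_cosets V l].
    move=> /nle[y [z [Vy Vz nBy nBz nByz]]].
    exists [:: x1; x2; y; z; y^-1 * z]; rewrite !inE !eqxx !orbT; split=> //.
      by move=> t; rewrite !inE => /or4P[/eqP->|/eqP->|/eqP->|/orP[]/eqP->].
    by exists y, z; rewrite !inE !eqxx !orbT.
  have [le1|/big[l [lB l1 l2 lV]]] := pselect (index_le2 V1 B); last first.
    by exists l; split=> //; constructor 2.
  have [le2|/big[l [lB l1 l2 lV]]] := pselect (index_le2 V2 B); last first.
    by exists l; split=> //; constructor 3.
  exists [:: x1; x2]; rewrite !inE !eqxx orbT; split=> //.
    by move=> t; rewrite !inE => /orP[]/eqP->.
  by constructor 1; apply/eqP => p2; apply: n2; split=> //; exact/has_index2P.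
have [gT [q [q_onto pG [n expT] q_dense q_sep]]] := separating_quotient lB.
set QB := ghom_im_group (q \o @set_val P B).
have qQB z : z \in l -> q z \notin QB.
  move=> zl; apply/negP => /ghom_imP[b _ /= qb].
  by apply: (q_sep z (set_val b) zl); [exact: set_valP|].
have gt1 (A : {group gT}) z : z \in l -> q z \in A -> (1 < #|A : QB|)%N.
  move=> /qQB nQ Aq; rewrite indexg_gt1; apply/negP => /fintype.subsetP/(_ _ Aq).
  exact/negP.
have gt2 (A : {group gT}) y z : y \in l -> z \in l -> y^-1 * z \in l ->
    q y \in A -> q z \in A -> (2 < #|A : QB|)%N.
  move=> /qQB nQy /qQB nQz /qQB; rewrite gmulfM gmulfV => nQyz Ay Az.
  have lc g : g \in A -> g *: QB \in lcosets QB A.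
    by move=> Ag; apply/lcosetsP; exists g.
  rewrite -card_lcosets; pose t := [:: 1 *: QB; q y *: QB; q z *: QB].
  have tsub : {subset t <= lcosets QB A}.
    by move=> D; rewrite !inE => /or3P[]/eqP->; exact: lc.
  have lc_neq g h : g^-1 * h \notin QB -> g *: QB != h *: QB.
    move=> nQ; apply/negP => /eqP E; move/negP: nQ; apply; rewrite -mem_lcoset.
    by rewrite E lcoset_refl.
  have tuniq : uniq t.
    by rewrite /= !inE !negb_or !lc_neq ?invg1 ?mul1g.
  have := subset_leq_card (introT fintype.subsetP tsub).
  by rewrite (card_uniqP tuniq).
have p_index (A : {group gT}) : p != 2 -> QB \subset A ->
    (1 < #|A : QB|)%N -> (2 < #|A : QB|)%N.
  move=> p2 QA; have : p.-nat #|A : QB|.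
    exact: (pnat_dvd (dvdn_indexg _ _)) (pgroupS (finset.subsetT _) pG).
  move/p_natP => [[|m] ->]; first by rewrite expn0.
  move=> _; apply: (@leq_trans p); last first.
    by rewrite expnS leq_pmulr // expn_gt0 prime_gt0.
  by rewrite ltn_neqAle eq_sym p2 prime_gt1.
pose A1 := ghom_im_group ((q \o rho) \o i1).
pose A2 := ghom_im_group ((q \o rho) \o i2).
have QA1 z : (V1 : set P) z -> q z \in A1 by exact: (q_V1 q_dense).
have QA2 z : (V2 : set P) z -> q z \in A2 by exact: (q_V2 q_dense).
have i1gt : (1 < #|A1 : QB|)%N by apply: (gt1 _ x1) => //; exact: QA1.
have i2gt : (1 < #|A2 : QB|)%N by apply: (gt1 _ x2) => //; exact: QA2.
have some_gt2 : (2 < #|A1 : QB|)%N \/ (2 < #|A2 : QB|)%N.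
  case: lbig => [p2|[y [z [Vy Vz yl zl yzl]]]|[y [z [Vy Vz yl zl yzl]]]].
  - by left; apply: p_index => //; exact: (QB1 q_dense).
  - by left; apply: (gt2 _ y z) => //; exact: QA1.
  - by right; apply: (gt2 _ y z) => //; exact: QA2.
have lt_index := index_im_lt q_dense i1gt i2gt some_gt2.
have [gT' [pi' [k [pi'_onto expT' large]]]] :=
  amalgam_large_quotient p_pr amalg (pi_onto q_onto q_dense) expT lt_index (size s).
rewrite -expnD in expT' large.
have := amalgam_quotient_bound p_pr compl sP pi'_onto expT'.
by rewrite leqNgt large.
Qed.

End Characterization.

Theorem theorem4p1 (p : nat) (K H1 H2 Gamma : groupType)
    (k1 : {ghom K -> H1}) (k2 : {ghom K -> H2})
    (i1 : {ghom H1 -> Gamma}) (i2 : {ghom H2 -> Gamma})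
    (P : topologicalGroupType) (rho : {ghom Gamma -> P}) :
  prime p ->
  is_amalgamated_product k1 k2 i1 i2 ->
  is_pro_p_completion p rho ->
  let V1 := closure_subgroup (range_subgroup (rho \o i1)) in
  let V2 := closure_subgroup (range_subgroup (rho \o i2)) in
  let B := setI_subgroup V1 V2 in
  let b1 : {ghom B -> V1} := subfun (@subIsetl P V1 V2) in
  let b2 : {ghom B -> V2} := subfun (@subIsetr P V1 V2) in
  let v1 : {ghom V1 -> P} := @set_val P V1 in
  let v2 : {ghom V2 -> P} := @set_val P V2 in
  (is_pro_p_pushout p b1 b2 v1 v2 /\
   forall (Q : topologicalGroupType)
     (j1 : {ghom V1 -> Q}) (j2 : {ghom V2 -> Q}),
     is_pro_p_pushout p b1 b2 j1 j2 ->
     [/\ exists theta : {ghom Q -> P},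
           [/\ topological_isomorphism theta,
               theta \o j1 =1 v1 & theta \o j2 =1 v2],
         injective j1 & injective j2]) /\
  (boundedly_generated H1 -> boundedly_generated H2 ->
   (topologically_boundedly_generated P <->
    (B = V1 :> set P \/ B = V2 :> set P) \/
    [/\ p = 2, has_index V1 B 2 & has_index V2 B 2])).
Proof.
move=> p_pr amalg compl V1 V2 B b1 b2 v1 v2; split.
  split; first exact: (completion_is_pushout p_pr compl amalg).
  exact: (pushout_unique p_pr compl amalg).
move=> bg1 bg2; split.
  exact: (boundedly_generated_degenerate p_pr amalg compl).
move=> deg; apply: (degenerate_boundedly_generated p_pr amalg compl bg1 bg2).
by case: deg => [|[_ ind1 ind2]]; [left|right].
Qed.
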